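(* Let $C\in\mathbb D$. Then: (1) Both $R_{\bar K_C,L_0}$ and $R_{\bar K_C^\flat,L_0}$ contain non-constant polynomials; in fact $R_{\bar K_C,L_0}=\{p\in\mathbb C[z]: p'(\lambda_i)=0,\ i=1,\dots,n\}$. (2) The set $\mathcal R_C:=\{K_C\,p(L_0)\,K_C^{-1}: p\in R_{\bar K_C,L_0}\}$ is a commutative ring of ordinary differential operators which is bispectral in the following sense: let $f$ be a nonzero element of $\ker L_0$, let $a^\flat(z)$ be the leading coefficient of $\bar K_C^\flat(z,\partial_z)$, and put $\phi(x,z)=\frac{1}{\tau_C(x)a^\flat(z)}\bar K_C(\hat f(x,z))$. Then for every $p\in R_{\bar K_C,L_0}$, $K_C p(L_0)K_C^{-1}\phi=p(z)\phi$, and for every $p\in R_{\bar K_C^\flat,L_0}$ the operator $P(z,\partial_z)=\tilde K^\flat\,p(L_0(z,\partial_z))\,(\tilde K^\flat)^{-1}$, where $\tilde K^\flat=\frac1{a^\flat(z)}\bar K_C^\flat(z,\partial_z)$, is a differential operator in $z$ satisfying $P(z,\partial_z)\phi=p(x)\phi$; and $R_{\bar K_C^\flat,L_0}$ contains non-constant polynomials.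
   Context: Fix an integer $r>1$ and constants $a_1,\dots,a_{r-2}\in\mathbb C$, and let $L_0=\partial^r-a_{r-2}\partial^{r-2}-\cdots-a_1\partial-x$, where $\partial=d/dx$. Fix a basis $f_1,\dots,f_r$ of $\ker L_0$ normalized so that the Wronskian determinant $|Wr(f_1,\dots,f_r)|=1$. For a function $f$ of one variable write $\hat f(x,z)=f(x+z)$. $\mathcal S$ denotes the space of finitely supported distributions in the $z$-plane: finite linear combinations of $\delta_\lambda\circ\partial_z^j$ ($\lambda\in\mathbb C$, $j\ge0$), where $\delta_\lambda$ evaluates its argument at $z=\lambda$; applied to a function $\psi(x,z)$ such a distribution acts in the $z$ variable and yields a function of $x$. $\mathbb D$ is the set of finite-dimensional subspaces $C\subset\mathcal S$ having a basis $c_i=\delta_{\lambda_i}\circ(\partial_z+\gamma_i)$, $i=1,\dots,n$ ($n\ge1$), with $\lambda_1,\dots,\lambda_n$ pairwise distinct and $\gamma_i\in\mathbb C$. For $C\in\mathbb D$ put $N=rn$ and let $\phi_1,\dots,\phi_N$ be the functions $c_i(\hat f_j)$ ($1\le i\le n$, $1\le j\le r$). $\bar K_C$ is the operator $u\mapsto\kappa\,|Wr(\phi_1,\dots,\phi_N,u)|$, where $\kappa$ is the nonzero constant for which the coefficient of $\partial^N$ is a monic polynomial (this coefficient is a polynomial of degree $n$); $\tau_C(x)$ denotes this leading coefficient and $K_C=\tau_C^{-1}\bar K_C$ (monic, with kernel spanned by $\phi_1,\dots,\phi_N$). Here $Wr(v_1,\dots,v_m)$ is the $m\times m$ matrix whose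 first row is $(v_1,\dots,v_m)$ and each subsequent row is the derivative of the previous one, and $|\cdot|$ is the determinant. The Weyl algebra is $\mathbb C[x]\langle\partial\rangle$; $\flat$ is the unique $\mathbb C$-linear anti-automorphism of the Weyl algebra with $x^\flat=L_0$, $\partial^\flat=\partial$; equivalently $T(x,\partial_x)\hat f(x,z)=T^\flat(z,\partial_z)\hat f(x,z)$ for all $f\in\ker L_0$, where $T(z,\partial_z)$ denotes $T$ with $x$ replaced by $z$. $\mathcal D$ is the ring of ordinary differential operators in $x$ with coefficients in $\mathbb C(x)$, and for operators $T,L$, $R_{T,L}:=\{p\in\mathbb C[z]: T\,p(L)\in\mathcal D\,T\}$. *)

(* Defs.v *)
From HB Require Import structures.
From mathcomp Require Import all_boot all_order all_algebra.
From mathcomp Require Import complex.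
From mathcomp Require Import all_classical all_reals all_analysis.
Set Implicit Arguments.
Unset Strict Implicit.
Unset Printing Implicit Defensive.
Import GRing.Theory Num.Theory.
Local Open Scope ring_scope.

(* the field of complex numbers, seen as a numFieldType (so that it is a
   normed module over itself and complex derivatives make sense) *)
Notation Cplx R := (R[i] : numFieldType).
Notation cfun R := (Cplx R -> (Cplx R)^o).

Section Bispectral.
Variable R : realType.
Local Notation C := (Cplx R).
Local Notation fn := (cfun R).

Definition dern (k : nat) (u : fn) : fn := derive1n k u.

Definition smooth (u : fn) : Prop :=
  forall k (x : C), derivable (dern k u : C^o -> C^o) x 1.

Definition inkerL0 (r : nat) (a : nat -> C) (u : fn) : Prop :=
  smooth u /\
  forall x : C, dern r u x = \sum_(1 <= k < r.-1) a k * dern k u x + x * u x.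

Definition Wr (m : nat) (v : nat -> fn) (x : C) : 'M[C]_m :=
  \matrix_(i < m, j < m) dern i (v j) x.

Definition Wrext (N : nat) (phi : nat -> fn) (u : fn) (x : C) : 'M[C]_N.+1 :=
  \matrix_(i < N.+1, j < N.+1) dern i (if (j < N)%N then phi j else u) x.

(* the functions c_i(\hat f_j) = f_j'(x + lam_i) + gam_i f_j(x + lam_i),
   enumerated as phi_k with i = k %/ r, j = k %% r, 0 <= k < r*n *)
Definition phiC (r : nat) (f : nat -> fn) (lam gam : nat -> C) (k : nat) : fn :=
  fun x => dern 1 (f (k %% r)%N) (x + lam (k %/ r)%N)
           + gam (k %/ r)%N * f (k %% r)%N (x + lam (k %/ r)%N).

Definition barK (r n : nat) (f : nat -> fn) (lam gam : nat -> C) (kappa : C)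
  (u : fn) : fn :=
  fun x => kappa * \det (Wrext (r * n) (phiC r f lam gam) u x).

(* An operator sum_k c_k d^k with coefficients in a commutative ring K with
   derivation delta is represented by the polynomial sum_k c_k 'X^k.
   Product:  (a d^i)(b d^j) = sum_k binom(i,k) a delta^k(b) d^(i+j-k). *)
Definition ore_mul (K : comNzRingType) (delta : K -> K) (T S : {poly K}) : {poly K} :=
  \sum_(i < size T) \sum_(j < size S) \sum_(k < i.+1)
     ((T`_i * iter k delta S`_j) *+ 'C(i, k))%:P * 'X^(i + j - k).

Definition ore_pow (K : comNzRingType) (delta : K -> K) (T : {poly K}) (m : nat) :=
  iter m (ore_mul delta T) 1.

Definition weyl := {poly {poly C}}.
Definition wmul (T S : weyl) : weyl := ore_mul (@deriv _) T S.

Definition whorner (p : {poly C}) (L : weyl) : weyl :=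
  \sum_(m < size p) (p`_m)%:P%:P * ore_pow (@deriv _) L m.

Definition L0w (r : nat) (a : nat -> C) : weyl :=
  'X^r - \sum_(1 <= k < r.-1) (a k)%:P%:P * 'X^k - ('X : {poly C})%:P.

(* the anti-automorphism flat: x |-> L0, d |-> d, so
   (sum_k p_k(x) d^k)^flat = sum_k d^k p_k(L0) *)
Definition wflat (L0 : weyl) (T : weyl) : weyl :=
  \sum_(k < size T) wmul 'X^k (whorner T`_k L0).

Definition wact (T : weyl) (u : fn) : fn :=
  fun x => \sum_(k < size T) (T`_k).[x] * dern k u x.

Definition ratf := {fraction {poly C}}.
Definition tofracC (p : {poly C}) : ratf := @FracField.tofrac {poly C} p.

Definition fderiv (c : ratf) : ratf :=
  let n := (frac (repr c)).1 in let d := (frac (repr c)).2 in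
  tofracC (n^`() * d - n * d^`()) / tofracC (d ^+ 2).

Definition Dop := {poly ratf}.
Definition Dmul (T S : Dop) : Dop := ore_mul fderiv T S.
Definition toD (T : weyl) : Dop := map_poly tofracC T.

(* value of a rational function at a point where (the chosen
   representative of) it is regular *)
Definition fregular (c : ratf) (x : C) : bool := (frac (repr c)).2.[x] != 0.
Definition feval (c : ratf) (x : C) : C := (frac (repr c)).1.[x] / (frac (repr c)).2.[x].

Definition Dregular (Q : Dop) (x : C) : Prop :=
  forall k, (k < size Q)%N -> fregular Q`_k x.

(* action of an element of D on functions (meaningful at regular points) *)
Definition Dact (Q : Dop) (u : fn) : fn :=
  fun x => \sum_(k < size Q) feval Q`_k x * dern k u x.

Definition RTL (T L : weyl) (p : {poly C}) : Prop :=
  exists Q : Dop, toD (wmul T (whorner p L)) = Dmul Q (toD T).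

End Bispectral.

(* Main.v *)
Require Import Defs.
From HB Require Import structures.
From mathcomp Require Import all_boot all_order all_algebra.
From mathcomp Require Import complex ring.
From mathcomp Require Import all_classical all_reals all_analysis.
Set Implicit Arguments.
Unset Strict Implicit.
Unset Printing Implicit Defensive.
Import GRing.Theory Num.Theory.
Local Open Scope ring_scope.

(* Write W for the Weyl algebra, D for d/dx, hat g for g(x + z), and c_i for
   the i-th condition.  As L0 (hat g) = z (hat g) and [L0, D] = 1, the operator
   p(L0) sends c_i (hat f_j) to p(lam_i) c_i (hat f_j) + p'(lam_i) f_j(. + lam_i).
   An operator killing all phi's is, up to a power of tau, a left multiple of
   Kb, which gives one inclusion in (1).  Conversely, if p'(lam_i) <> 0 then Kb
   kills the f_j(. + lam_i); at a point where tau <> 0 the jet of f_0(. + lam_i)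
   is then a combination of the jets of the phi's, and applying suitable
   polynomials in L0 contradicts Wr(f) = 1.

   For the flat side let d = prod (X - lam_i)^2, so that tau^m d(L0) = Q Kb.
   Since flat turns S d(L0)^M in d(L0) W into d^M S^flat in W d, every S in W
   satisfies the former for large M.  Choosing p = x tau^(mM') with Q p in tau^m W
   and S = tau^-m Q p Kb, one gets Q p Kb d(L0)^M in Q Kb W; cancelling Q and
   applying flat yields d^M Kb^flat p(L0) in W Kb^flat.

   Bispectrality follows by clearing denominators on both sides of
   Q K_C = K_C p(L0), and the equation in z reduces to the one in x because Kb
   in x and Kb^flat in z act equally on g(x + z). *)

(** * Ore polynomials over a differential ring *)

Section OreProduct.
Variables (K : comNzRingType) (d : K -> K).
Hypothesis dD : {morph d : a b / a + b}.
Hypothesis dM : forall a b, d (a * b) = d a * b + a * d b.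

Implicit Types S T U : {poly K}.

Definition ddx (S : {poly K}) : {poly K} := map_poly d S + 'X * S.

Lemma der0 : d 0 = 0.
Proof. by apply: (addrI (d 0)); rewrite -dD !addr0. Qed.

Lemma der1 : d 1 = 0.
Proof. by apply: (addrI (d 1)); rewrite addr0 -{3}(mulr1 1) dM mulr1 mul1r. Qed.

Lemma coef_ddx S j : (ddx S)`_j = d S`_j + (if j is k.+1 then S`_k else 0).
Proof.
by rewrite coefD coef_map_id0 ?der0 // coefXM; case: j.
Qed.

Lemma ddxD : {morph ddx : S U / S + U}.
Proof.
move=> S U; apply/polyP=> j; rewrite !(coef_ddx, coefD) dD addrACA.
by congr (_ + _); case: j => [|j]; rewrite ?addr0 ?coefD.
Qed.

Lemma ddx0 : ddx 0 = 0.
Proof. by apply: (addrI (ddx 0)); rewrite -ddxD !addr0. Qed.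

Lemma ddx_sum I (s : seq I) (P : pred I) F :
  ddx (\sum_(i <- s | P i) F i) = \sum_(i <- s | P i) ddx (F i).
Proof. exact: (big_morph _ ddxD ddx0). Qed.

Lemma ddxCM c S : ddx (c%:P * S) = (d c)%:P * S + c%:P * ddx S.
Proof.
apply/polyP=> j; rewrite !(coef_ddx, coefD, coefCM) dM mulrDr addrA.
by case: j => [|j]; rewrite ?mulr0 ?coefCM.
Qed.

Lemma ddxCXn c m : ddx (c%:P * 'X^m) = (d c)%:P * 'X^m + c%:P * 'X^(m.+1).
Proof.
rewrite ddxCM; congr (_ + _); congr (_ * _); apply/polyP=> j.
rewrite coef_ddx !coefXn; case: j => [|j]; rewrite ?eqSS.
  by case: (m) => [|?]; rewrite /= ?der0 ?der1 ?addr0.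
by rewrite coefXn; case: (_.+1 == m); rewrite ?der0 ?der1 ?add0r.
Qed.

Lemma ddxMn S m : ddx (S *+ m) = ddx S *+ m.
Proof. by elim: m => [|m IH]; rewrite ?mulr0n ?ddx0 // !mulrS ddxD IH. Qed.

Lemma iter_ddxD i : {morph iter i ddx : S U / S + U}.
Proof. by elim: i => [|i IH] S U //=; rewrite IH ddxD. Qed.

Lemma iter_ddx0 i : iter i ddx 0 = 0.
Proof. by elim: i => [|i IH] //=; rewrite IH ddx0. Qed.

Lemma iter_ddx_sum i I (s : seq I) (P : pred I) F :
  iter i ddx (\sum_(j <- s | P j) F j) = \sum_(j <- s | P j) iter i ddx (F j).
Proof. exact: (big_morph _ (iter_ddxD i) (iter_ddx0 i)). Qed.

(** Leibniz rule for [d^i b d^j]; the induction on [i] splits each binomial by Pascal's rule. Up to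
    a left coefficient, this is the inner sum of [ore_mul]. *)
Lemma iter_ddxCXn i b j : iter i ddx (b%:P * 'X^j) =
  \sum_(k < i.+1) ((iter k d b)%:P * 'X^(i + j - k)) *+ 'C(i, k).
Proof.
elim: i => [|i IH]; first by rewrite big_ord1 /= add0n subn0 bin0.
rewrite iterS IH ddx_sum.
under eq_bigr do rewrite ddxMn ddxCXn mulrnDl.
rewrite big_split /= [RHS]big_ord_recl.
under [X in _ = _ + X]eq_bigr => k _ do rewrite lift0 binS mulrnDr.
rewrite big_split /= addrC addrA; congr (_ + _).
rewrite [LHS]big_ord_recl /= [in RHS]big_ord_recr /= (bin_small (ltnSn i)) mulr0n addr0.
rewrite !bin0 !subn0 addSn; congr (_ + _); apply: eq_bigr => k _.
rewrite -subSn ?subSS //.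
by rewrite (leq_trans (ltn_ord k)) // leq_addr.
Qed.

(* [T] evaluated at [ddx], the left multiplication by 'X; associativity is
   immediate in this form, unlike in the binomial formula defining [ore_mul]. *)
Definition ore_eval (T S : {poly K}) := \sum_(i < size T) (T`_i)%:P * iter i ddx S.

Lemma ore_mulE T S : ore_mul d T S = ore_eval T S.
Proof.
apply: eq_bigr => i _; rewrite [in RHS](_ : S = \sum_(j < size S) (S`_j)%:P * 'X^j).
  rewrite iter_ddx_sum mulr_sumr; apply: eq_bigr => j _.
  rewrite iter_ddxCXn mulr_sumr; apply: eq_bigr => k _.
    by rewrite polyCMn polyCM mulrnAl mulrnAr mulrA.
by rewrite -[LHS]coefK poly_def; apply: eq_bigr => j _; rewrite mul_polyC.
Qed.

Lemma ore_evalE m T S : (size T <= m)%N -> ore_eval T S = \sum_(i < m) (T`_i)%:P * iter i ddx S.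
Proof.
move=> h; rewrite /ore_eval (big_ord_widen _ (fun i => (T`_i)%:P * iter i ddx S) h).
rewrite big_mkcond; apply: eq_bigr => i _; case: ltnP => // hi.
by rewrite nth_default // polyC0 mul0r.
Qed.

Lemma ore_evalDl T U S : ore_eval (T + U) S = ore_eval T S + ore_eval U S.
Proof.
pose m := maxn (size T) (size U).
rewrite !(@ore_evalE m) ?leq_maxl ?leq_maxr ?size_polyD // -big_split /=.
by apply: eq_bigr => i _; rewrite coefD polyCD mulrDl.
Qed.

Lemma ore_evalDr T U S : ore_eval T (U + S) = ore_eval T U + ore_eval T S.
Proof.
by rewrite /ore_eval -big_split /=; apply: eq_bigr => i _; rewrite iter_ddxD mulrDr.
Qed.

Lemma ore_eval0l S : ore_eval 0 S = 0.
Proof. by rewrite /ore_eval size_poly0 big_ord0. Qed.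

Lemma ore_evalCM c T S : ore_eval (c%:P * T) S = c%:P * ore_eval T S.
Proof.
rewrite (@ore_evalE (size T)) /ore_eval ?mulr_sumr.
  by apply: eq_bigr => i _; rewrite coefCM polyCM mulrA.
by rewrite mul_polyC size_scale_leq.
Qed.

Lemma ore_eval_suml I (s : seq I) (P : pred I) F S :
  ore_eval (\sum_(i <- s | P i) F i) S = \sum_(i <- s | P i) ore_eval (F i) S.
Proof. exact: (big_morph (fun T => ore_eval T S) (fun T U => ore_evalDl T U S) (ore_eval0l S)). Qed.

Lemma ore_evalXn i S : ore_eval 'X^i S = iter i ddx S.
Proof.
rewrite (@ore_evalE i.+1) ?size_polyXn // big_ord_recr /= coefXn eqxx mul1r.
rewrite big1 ?add0r // => j _; rewrite coefXn.
by rewrite (ltn_eqF (ltn_ord j)) polyC0 mul0r.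
Qed.

Lemma ore_eval1l S : ore_eval 1 S = S.
Proof. by have := ore_evalXn 0 S; rewrite expr0. Qed.

Lemma ore_evalCl c S : ore_eval c%:P S = c%:P * S.
Proof. by rewrite -{1}[c%:P]mulr1 ore_evalCM ore_eval1l. Qed.

Lemma ore_evalXl S : ore_eval 'X S = ddx S.
Proof. exact: (ore_evalXn 1). Qed.

Lemma iter_ddxCXn1 i j : iter i ddx 'X^j = 'X^(i + j).
Proof.
elim: i => [|i IH] //; rewrite iterS IH -['X^(i + j)]mul1r -polyC1 ddxCXn.
by rewrite der1 polyC0 mul0r add0r polyC1 mul1r.
Qed.

Lemma poly_as_sum (S : {poly K}) : S = \sum_(j < size S) (S`_j)%:P * 'X^j.
Proof. by rewrite -[LHS]coefK poly_def; apply: eq_bigr => j _; rewrite mul_polyC. Qed.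

Lemma ore_eval1r T : ore_eval T 1 = T.
Proof.
rewrite [RHS]poly_as_sum; apply: eq_bigr => i _.
by have := iter_ddxCXn1 i 0; rewrite expr0 addn0 => ->.
Qed.

(** Associativity when the left factor is the generator. As [ore_eval] is built from iterates of
    [ddx], the general case [ore_evalA] follows by induction. *)
Lemma ore_eval_ddx S U : ore_eval (ddx S) U = ddx (ore_eval S U).
Proof.
rewrite [in LHS](poly_as_sum S) ddx_sum ore_eval_suml ddx_sum; apply: eq_bigr => i _.
by rewrite ddxCXn ddxCM ore_evalDl !ore_evalCM !ore_evalXn.
Qed.

Lemma ore_evalA T S U : ore_eval T (ore_eval S U) = ore_eval (ore_eval T S) U.
Proof.
rewrite [ore_eval T S]/ore_eval ore_eval_suml; apply: eq_bigr => i _; rewrite ore_evalCM.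
by congr (_ * _); elim: (i : nat) => [|k IH] //=; rewrite IH ore_eval_ddx.
Qed.

Lemma ore_mulA : associative (ore_mul d).
Proof. by move=> T S U; rewrite !ore_mulE ore_evalA. Qed.
Lemma ore_mul1l : left_id 1 (ore_mul d).
Proof. by move=> T; rewrite ore_mulE ore_eval1l. Qed.
Lemma ore_mul1r : right_id 1 (ore_mul d).
Proof. by move=> T; rewrite ore_mulE ore_eval1r. Qed.
Lemma ore_mulDl : left_distributive (ore_mul d) +%R.
Proof. by move=> T S U; rewrite !ore_mulE ore_evalDl. Qed.
Lemma ore_mulDr : right_distributive (ore_mul d) +%R.
Proof. by move=> T S U; rewrite !ore_mulE ore_evalDr. Qed.
Lemma ore_mulCl c S : ore_mul d c%:P S = c%:P * S.
Proof. by rewrite ore_mulE ore_evalCl. Qed.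
Lemma ore_mulXl S : ore_mul d 'X S = map_poly d S + 'X * S.
Proof. by rewrite ore_mulE ore_evalXl. Qed.
Lemma ore_mulXnXn i j : ore_mul d 'X^i 'X^j = 'X^(i + j).
Proof. by rewrite ore_mulE ore_evalXn iter_ddxCXn1. Qed.

Lemma size_iter_ddx n S i : (size S <= n)%N -> (size (iter i ddx S) <= i + n)%N.
Proof.
move=> h; elim: i => [|i IH] //; rewrite iterS; apply/leq_sizeP => -[|j] //.
rewrite addSn ltnS => hj; rewrite coef_ddx.
move/leq_sizeP: IH => IH; rewrite !IH ?der0 ?addr0 //.
exact: leqW.
Qed.

Lemma coef_iter_ddx n S i : (size S <= n.+1)%N -> (iter i ddx S)`_(i + n) = S`_n.
Proof.
move=> h; elim: i => [|i IH] //; rewrite iterS addSn coef_ddx IH.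
have /leq_sizeP -> // := size_iter_ddx i h; first by rewrite der0 add0r.
by rewrite addnS.
Qed.

Lemma size_ore_mul m n T S : (size T <= m.+1)%N -> (size S <= n.+1)%N ->
  (size (ore_mul d T S) <= (m + n).+1)%N.
Proof.
move=> hT hS; rewrite ore_mulE (ore_evalE _ hT).
apply/leq_sizeP => j hj; rewrite coef_sum big1 // => i _; rewrite coefCM.
have /leq_sizeP -> := size_iter_ddx i hS; rewrite ?mulr0 //.
by rewrite (leq_trans _ hj) // addnS ltnS leq_add2r -ltnS.
Qed.

(** Differentiating a coefficient lowers the power of the generator, so only the commutative product
    survives in top degree. *)
Lemma coef_ore_mul m n T S : (size T <= m.+1)%N -> (size S <= n.+1)%N ->
  (ore_mul d T S)`_(m + n) = T`_m * S`_n.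
Proof.
move=> hT hS; rewrite ore_mulE (ore_evalE _ hT) coef_sum big_ord_recr /= coefCM.
rewrite coef_iter_ddx // big1 ?add0r // => i _; rewrite coefCM.
have /leq_sizeP -> := size_iter_ddx i hS; rewrite ?mulr0 //.
by rewrite addnS -addSn leq_add2r.
Qed.

(* The proofs that [d] is a derivation are parameters of the type, so that the
   ring instance can be inferred from it. *)
Definition ore (_ : {morph d : a b / a + b})
  (_ : forall a b, d (a * b) = d a * b + a * d b) : Type := {poly K}.

Local Notation oreK := (ore dD dM).
HB.instance Definition _ := GRing.Zmodule.copy oreK {poly K}.
Fact ore_1_neq0 : (1 : {poly K}) != 0 :> oreK.
Proof. exact: oner_neq0. Qed.
HB.instance Definition _ := GRing.Zmodule_isNzRing.Build oreK
  ore_mulA ore_mul1l ore_mul1r ore_mulDl ore_mulDr ore_1_neq0.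

End OreProduct.

Section OreDomain.
Variables (K : idomainType) (d : K -> K).
Hypothesis dD : {morph d : a b / a + b}.
Hypothesis dM : forall a b, d (a * b) = d a * b + a * d b.

Lemma ore_mul_neq0 T S : T != 0 -> S != 0 -> ore_mul d T S != 0.
Proof.
move=> T0 S0; apply/eqP => /(congr1 (fun p : {poly K} => p`_((size T).-1 + (size S).-1))).
rewrite coef_ore_mul ?prednK ?lt0n ?size_poly_eq0 // coef0 => /eqP.
by rewrite mulf_eq0 -!lead_coefE !lead_coef_eq0 (negPf T0) (negPf S0).
Qed.

Lemma ore_mulIf (T S U : ore dD dM) : U != 0 -> T * U = S * U -> T = S.
Proof.
move=> U0 /eqP; rewrite -subr_eq0 -mulrBl => h; apply/eqP; rewrite -subr_eq0.
by apply: contraLR h => TS; apply: ore_mul_neq0.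
Qed.

Lemma ore_mulfI (T S U : ore dD dM) : U != 0 -> U * T = U * S -> T = S.
Proof.
move=> U0 /eqP; rewrite -subr_eq0 -mulrBr => h; apply/eqP; rewrite -subr_eq0.
by apply: contraLR h => TS; apply: ore_mul_neq0.
Qed.

End OreDomain.

Lemma map_ore_mul (K K' : comNzRingType) (d : K -> K) (d' : K' -> K')
  (h : {rmorphism K -> K'}) (T S : {poly K}) :
  {morph d : a b / a + b} -> (forall a b, d (a * b) = d a * b + a * d b) ->
  {morph d' : a b / a + b} -> (forall a b, d' (a * b) = d' a * b + a * d' b) ->
  (forall c, h (d c) = d' (h c)) ->
  map_poly h (ore_mul d T S) = ore_mul d' (map_poly h T) (map_poly h S).
Proof.
move=> dD dM d'D d'M hd; rewrite !ore_mulE // (@ore_evalE _ d' (size T)).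
  rewrite [LHS](raddf_sum (map_poly h)); apply: eq_bigr => i _.
  rewrite coef_map /= rmorphM /= map_polyC /=; congr (_ * _).
  elim: (i : nat) => [|k IH] //=; rewrite -IH.
  apply/polyP => j; rewrite coef_map /= !coef_ddx // rmorphD /= hd coef_map /=.
  by case: j => [|j]; rewrite ?rmorph0 ?coef_map.
exact: size_poly.
Qed.

(** * The derivation on rational functions *)

(** The primed letters are independent variables standing for derivatives. The last hypothesis is
    the derivative of [n D = N d], which says that both fractions equal [c]. *)
Lemma quotient_rule (F : fieldType) (c N D n d N' D' n' d' : F) :
  D != 0 -> d != 0 -> c * D = N -> c * d = n ->
  n' * D + n * D' = N' * d + N * d' ->
  (N' * D - N * D') / (D ^+ 2) = (n' - c * d') / d.
Proof.
move=> D0 d0 <- <- e.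
have -> : N' = (n' * D + c * d * D' - c * D * d') / d by rewrite e addrK mulfK.
by field; rewrite d0 D0.
Qed.

Section Frac.
Variable R : realType.
Local Notation C := (Cplx R).

HB.instance Definition _ := GRing.RMorphism.copy (@tofracC R) (@FracField.tofrac {poly C}).

Lemma tofracC_eq0 (p : {poly C}) : (tofracC p == 0) = (p == 0).
Proof. exact: tofrac_eq0. Qed.

Lemma tofracC_inj : injective (@tofracC R).
Proof. by move=> p q /eqP; rewrite [_ == _]tofrac_eq => /eqP. Qed.

Lemma ratf_denP (c : ratf R) : (frac (repr c)).2 != 0.
Proof. exact: denom_ratioP. Qed.

Lemma ratfE (c : ratf R) :
  c * tofracC (frac (repr c)).2 = tofracC (frac (repr c)).1.
Proof.
set D := _.2; set N := _.1; rewrite -[c in LHS]reprK.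
rewrite /tofracC; rewrite !piE /=.
apply/eqmodP; rewrite /= FracField.equivfE /FracField.mulf.
rewrite !numden_Ratio ?mulf_neq0 ?oner_neq0 ?ratf_denP //.
by rewrite !mulr1 -/D -/N mulrC.
Qed.

(** [fderiv] is computed from a chosen representative. Any other fraction for [c] gives the same
    value, so sums and products may use their natural denominators. *)
Lemma fderiv_frac (c : ratf R) (n d : {poly C}) : d != 0 ->
  c * tofracC d = tofracC n ->
  fderiv c = (tofracC n^`() - c * tofracC d^`()) / tofracC d.
Proof.
rewrite /fderiv; have := ratf_denP c; have := ratfE c.
move: (_.1) (_.2) => N D hc D0 d0 hn.
have e : n * D = N * d.
  by apply: tofracC_inj; rewrite !rmorphM /= -hn -hc mulrAC.
have tD : tofracC D != 0 by rewrite tofracC_eq0.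
have td : tofracC d != 0 by rewrite tofracC_eq0.
have := congr1 (fun p => tofracC p^`()) e.
rewrite !derivM !rmorphD rmorphN /= !rmorphM /= => e'.
exact: quotient_rule tD td hc hn e'.
Qed.

Lemma add_quotient (F : fieldType) (a b n d m e n' d' m' e' : F) :
  d != 0 -> e != 0 -> a * d = n -> b * e = m ->
  (n' * e + n * e' + (m' * d + m * d') - (a + b) * (d' * e + d * e')) / (d * e) =
  (n' - a * d') / d + (m' - b * e') / e.
Proof. by move=> d0 e0 <- <-; field; rewrite d0 e0. Qed.

Lemma mul_quotient (F : fieldType) (a b n d m e n' d' m' e' : F) :
  d != 0 -> e != 0 -> a * d = n -> b * e = m ->
  (n' * m + n * m' - (a * b) * (d' * e + d * e')) / (d * e) =
  (n' - a * d') / d * b + a * ((m' - b * e') / e).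
Proof. by move=> d0 e0 <- <-; field; rewrite d0 e0. Qed.

Lemma fderivD : {morph @fderiv R : a b / a + b}.
Proof.
move=> a b; have := ratf_denP a; have := ratfE a; have := ratf_denP b; have := ratfE b.
move: (frac (repr a)) (frac (repr b)) => [n d] [m e] /= hb e0 ha d0.
rewrite (fderiv_frac d0 ha) (fderiv_frac e0 hb).
rewrite (@fderiv_frac _ (n * e + m * d) (d * e)) ?mulf_neq0 //; last first.
  by rewrite rmorphD !rmorphM /= -ha -hb mulrDl !mulrA; congr (_ + _); rewrite mulrAC.
rewrite derivD !derivM !rmorphD !rmorphM /=.
rewrite -!tofracC_eq0 in d0 e0.
pose F : fieldType := ratf R.
have H := @add_quotient F a b (tofracC n) (tofracC d) (tofracC m) (tofracC e)
  (tofracC n^`()) (tofracC d^`()) (tofracC m^`()) (tofracC e^`()) d0 e0.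
exact: H ha hb.
Qed.

Lemma fderivM (a b : ratf R) : fderiv (a * b) = fderiv a * b + a * fderiv b.
Proof.
have := ratf_denP a; have := ratfE a; have := ratf_denP b; have := ratfE b.
move: (frac (repr a)) (frac (repr b)) => [n d] [m e] /= hb e0 ha d0.
rewrite (fderiv_frac d0 ha) (fderiv_frac e0 hb).
rewrite (@fderiv_frac _ (n * m) (d * e)) ?mulf_neq0 //; last first.
  by rewrite !rmorphM /= -ha -hb mulrACA.
rewrite !derivM !rmorphD !rmorphM /=.
rewrite -!tofracC_eq0 in d0 e0.
pose F : fieldType := ratf R.
have H := @mul_quotient F a b (tofracC n) (tofracC d) (tofracC m) (tofracC e)
  (tofracC n^`()) (tofracC d^`()) (tofracC m^`()) (tofracC e^`()) d0 e0.
exact: H ha hb.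
Qed.

Lemma fderiv_tofrac (p : {poly C}) : fderiv (tofracC p) = tofracC p^`().
Proof.
rewrite (@fderiv_frac _ p 1) ?oner_neq0 ?rmorph1 ?mulr1 //.
by rewrite -polyC1 derivC rmorph0 mulr0 subr0 divr1.
Qed.

End Frac.

(** * The Weyl algebra and its localization *)

Section WeylAlgebra.
Variable R : realType.
Local Notation C := (Cplx R).

Definition weylR := ore (@derivD C) (@derivM C).
Definition DopR := ore (@fderivD R) (@fderivM R).
HB.instance Definition _ := GRing.NzRing.on weylR.
HB.instance Definition _ := GRing.NzRing.on DopR.

Definition cW (p : {poly C}) : weylR := p%:P.
Definition dW : weylR := 'X.
Definition cD (c : ratf R) : DopR := c%:P.
Definition toDr : weylR -> DopR := @toD R.

Fact cW_zmod : zmod_morphism cW.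
Proof. by move=> p q; exact: polyCB. Qed.
Fact cW_monoid : monoid_morphism cW.
Proof.
by split=> [//|p q]; rewrite /cW polyCM; exact/esym/(ore_mulCl (@derivD C) (@derivM C)).
Qed.
HB.instance Definition _ := GRing.isZmodMorphism.Build _ _ cW cW_zmod.
HB.instance Definition _ := GRing.isMonoidMorphism.Build _ _ cW cW_monoid.

Fact cD_zmod : zmod_morphism cD.
Proof. by move=> p q; exact: polyCB. Qed.
Fact cD_monoid : monoid_morphism cD.
Proof.
by split=> [//|p q]; rewrite /cD polyCM; exact/esym/(ore_mulCl (@fderivD R) (@fderivM R)).
Qed.
HB.instance Definition _ := GRing.isZmodMorphism.Build _ _ cD cD_zmod.
HB.instance Definition _ := GRing.isMonoidMorphism.Build _ _ cD cD_monoid.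

Fact toDr_zmod : zmod_morphism toDr.
Proof. by move=> T S; exact: (raddfB (map_poly (@tofracC R))). Qed.
Fact toDr_monoid : monoid_morphism toDr.
Proof.
split=> [|T S]; first exact: (rmorph1 (map_poly (@tofracC R))).
apply: map_ore_mul; [exact: derivD|exact: derivM|exact: fderivD|exact: fderivM|].
by move=> c; rewrite fderiv_tofrac.
Qed.
HB.instance Definition _ := GRing.isZmodMorphism.Build _ _ toDr toDr_zmod.
HB.instance Definition _ := GRing.isMonoidMorphism.Build _ _ toDr toDr_monoid.

Lemma toDr_inj : injective toDr.
Proof.
move=> T S /(congr1 (fun p : {poly _} => p`_(_ : nat))) h; apply/polyP => i.
by apply: tofracC_inj; have := h i; rewrite !coef_map.
Qed.

Lemma toDr_cW p : toDr (cW p) = cD (tofracC p).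
Proof. exact: map_polyC. Qed.

Lemma coefcW p (T : weylR) i : (cW p * T : {poly _})`_i = p * (T : {poly _})`_i.
Proof.
by rewrite [cW p * T](ore_mulCl (@derivD C) (@derivM C)) coefCM.
Qed.

Lemma coefcD p (T : DopR) i : (cD p * T : {poly _})`_i = p * (T : {poly _})`_i.
Proof.
by rewrite [cD p * T](ore_mulCl (@fderivD R) (@fderivM R)) coefCM.
Qed.

Lemma weyl_mulfI (T S U : weylR) : U != 0 -> U * T = U * S -> T = S.
Proof. exact: ore_mulfI. Qed.
Lemma Dop_mulIf (T S U : DopR) : U != 0 -> T * U = S * U -> T = S.
Proof. exact: ore_mulIf. Qed.

Lemma weyl_mul_neq0 (T S : weylR) : T != 0 -> S != 0 -> T * S != 0.
Proof. exact: (ore_mul_neq0 (@derivD C) (@derivM C)). Qed.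

Lemma cW_eq0 p : (cW p == 0) = (p == 0).
Proof. by apply/eqP/eqP => [/(@polyC_inj _ p 0)|->]; rewrite ?raddf0. Qed.

Lemma toDr_eq0 T : (toDr T == 0) = (T == 0).
Proof. by rewrite -(inj_eq toDr_inj) raddf0. Qed.

Lemma dWcW p : dW * cW p = cW p * dW + cW p^`().
Proof.
rewrite [LHS](ore_mulXl (@derivD C) (@derivM C)) [X in _ = X + _](ore_mulCl (@derivD C) (@derivM C)).
by rewrite map_polyC /= addrC mulrC.
Qed.

Lemma dWXn i : dW ^+ i = 'X^i :> {poly {poly C}}.
Proof.
elim: i => [|i IH] //; rewrite exprS IH.
exact: (ore_mulXnXn (@derivD C) (@derivM C) 1 i).
Qed.

Lemma weylE m (T : weylR) : (size (T : {poly _}) <= m)%N ->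
  T = \sum_(i < m) cW (T : {poly _})`_i * dW ^+ i.
Proof.
move=> hm; apply/polyP => j.
rewrite [in RHS](_ : (\sum_(i < m) _ : weylR) =
   \sum_(i < m) (T : {poly _})`_i *: 'X^i :> {poly _}); last first.
  apply: eq_bigr => i _; rewrite dWXn.
  by rewrite [LHS](ore_mulCl (@derivD C) (@derivM C)) mul_polyC.
rewrite -poly_def coef_poly; case: ltnP => // hj.
by rewrite nth_default // (leq_trans hm).
Qed.

Lemma weyl_ind (P : weylR -> Prop) :
  (forall T S, P T -> P S -> P (T + S)) ->
  (forall p i, P (cW p * dW ^+ i)) -> forall T, P T.
Proof.
move=> PD Pm T; rewrite (@weylE _ T (leqnn _)); apply: big_ind => //.
by have := Pm 0 0%N; rewrite raddf0 mul0r.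
Qed.

Definition cstW (c : C) : weylR := cW c%:P.
HB.instance Definition _ := GRing.RMorphism.copy cstW (cW \o polyC).

(** Centrality of constants is what evaluating a complex polynomial at an operator requires. *)
Lemma cstW_comm (T : weylR) : commr_rmorph cstW T.
Proof.
move=> c; rewrite /GRing.comm; elim/weyl_ind: T => [T S h1 h2|p i].
  by rewrite mulrDl mulrDr h1 h2.
have h : GRing.comm (cstW c) (dW ^+ i).
  by apply: commrX; rewrite /GRing.comm /cstW dWcW derivC raddf0 addr0.
by rewrite -mulrA -h !mulrA /cstW -!rmorphM /= [p * _]mulrC.
Qed.

Definition evalW (L : weylR) : {poly C} -> weylR := horner_morph (cstW_comm L).
HB.instance Definition _ L := GRing.RMorphism.copy (evalW L) (horner_morph (cstW_comm L)).

Lemma evalWX L : evalW L 'X = L.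
Proof. exact: horner_morphX. Qed.

Lemma evalWC L c : evalW L c%:P = cstW c.
Proof. exact: horner_morphC. Qed.

Lemma whornerE p (L : weylR) : whorner p L = evalW L p.
Proof.
rewrite /evalW /horner_morph (@horner_coef_wide _ (size p)) ?size_poly //.
apply: eq_bigr => i _; rewrite coef_map /=.
rewrite [RHS](ore_mulCl (@derivD C) (@derivM C)); congr (_ * _).
by elim: (i : nat) => [|k IH] //; rewrite exprS -IH.
Qed.

Lemma wmulE (T S : weylR) : wmul T S = T * S :> weylR. Proof. by []. Qed.

Lemma poly_lin_ind (P : {poly C} -> Prop) :
  (forall c, P c%:P) -> (forall p q, P p -> P q -> P (p + q)) ->
  (forall p, P p -> P (p * 'X)) -> forall p, P p.
Proof.
move=> PC PD PX p; elim/poly_ind: p => [|p c IH]; first by rewrite -polyC0.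
by apply: PD => //; apply: PX.
Qed.

(* Commuting [dW] past a power of [q] costs a single factor [q]. *)
Lemma ore_right (q : {poly C}) (S : weylR) e :
  exists M, exists S', S * cW (q ^+ M) = cW (q ^+ e) * S'.
Proof.
elim/weyl_ind: S e => [T S IHT IHS|p i] e.
  have [M [T' hT]] := IHT e; have [N [S' hS]] := IHS e.
  exists (M + N)%N, (T' * cW (q ^+ N) + S' * cW (q ^+ M)).
  rewrite mulrDr !mulrA -hT -hS mulrDl -!mulrA -!rmorphM /= -!exprD.
  by rewrite [in X in _ + X]addnC.
suff [M [S' hS]] : exists M, exists S', dW ^+ i * cW (q ^+ M) = cW (q ^+ e) * S'.
  by exists M, (cW p * S'); rewrite -mulrA hS !mulrA -!rmorphM /= mulrC.
elim: i e => [|i IH] e; first by exists e, 1; rewrite mul1r mulr1.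
have [M [S' hS]] := IH e.+1; exists M, ((cW q * dW + cW (q^`() *+ e.+1)) * S').
rewrite exprS -mulrA hS mulrA dWcW deriv_exp mulrA; congr (_ * _).
rewrite mulrDr mulrA -!rmorphM /= -exprSr; congr (_ + cW _).
by rewrite mulrnAr mulrC.
Qed.

(** Mirror image of [ore_right], resting on [q^(e+1) d = (d q - (e+1) q') q^e]. *)
Lemma ore_left (q : {poly C}) (S : weylR) e :
  exists M, exists S', cW (q ^+ M) * S = S' * cW (q ^+ e).
Proof.
elim/weyl_ind: S e => [T S IHT IHS|p i] e.
  have [M [T' hT]] := IHT e; have [N [S' hS]] := IHS e.
  exists (M + N)%N, (cW (q ^+ N) * T' + cW (q ^+ M) * S').
  rewrite mulrDl -!mulrA -hT -hS mulrDr !mulrA -!rmorphM /= -!exprD.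
  by rewrite [in X in X * _ + _]addnC.
elim: i e => [|i IH] e.
  by exists e, (cW p); rewrite expr0 mulr1 -!rmorphM /= mulrC.
have [M [S' hS]] := IH e.+1.
exists M, (S' * (dW * cW q - cW (q^`() *+ e.+1))).
rewrite exprSr [cW p * _]mulrA [LHS]mulrA hS -!mulrA; congr (_ * _).
by rewrite mulrBl -mulrA -!rmorphM /= -exprS dWcW deriv_exp mulrnAl addrK.
Qed.

End WeylAlgebra.

(** * The anti-automorphism flat *)

Section Flat.
Variable R : realType.
Local Notation C := (Cplx R).
Local Notation weylR := (weylR R).
Local Notation dW := (dW R).
Variables (r : nat) (a : nat -> C).

Definition L0R : weylR := L0w r a.

Lemma L0E : L0R = dW ^+ r - \sum_(1 <= k < r.-1) cstW (a k) * dW ^+ k - cW 'X.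
Proof.
rewrite /L0R /L0w; congr (_ - _ - _); first by rewrite dWXn.
apply: eq_bigr => k _; rewrite dWXn.
by rewrite [RHS](ore_mulCl (@derivD C) (@derivM C)).
Qed.

(** Only the term [- x] of [L0] fails to commute with [dW]. *)
Lemma L0dW : L0R * dW = dW * L0R + 1.
Proof.
rewrite L0E !mulrBl !mulrBr dWcW derivX rmorph1 -!exprS -!exprSr opprD addrA subrK.
congr (_ - _ - _); rewrite mulr_suml mulr_sumr; apply: eq_bigr => k _.
by rewrite [RHS]mulrA (cstW_comm dW) -!mulrA -exprS -exprSr.
Qed.

Local Notation ev := (evalW L0R).

Lemma evalL0_dW p : ev p * dW = dW * ev p + ev p^`().
Proof.
elim/poly_lin_ind: p => [c|p q hp hq|p hp].
- by rewrite evalWC derivC rmorph0 addr0; exact/esym/cstW_comm.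
- by rewrite derivD !rmorphD /= mulrDl mulrDr hp hq addrACA.
rewrite derivM derivX mulr1 rmorphD !rmorphM /= evalWX -mulrA L0dW mulrDr mulr1.
by rewrite !mulrA hp mulrDl addrA.
Qed.

Definition flat (T : weylR) : weylR := wflat L0R T.

Lemma flatE m (T : weylR) : (size (T : {poly _}) <= m)%N ->
  flat T = \sum_(k < m) dW ^+ k * ev (T : {poly _})`_k.
Proof.
move=> hm; rewrite /flat /wflat.
rewrite (big_ord_widen _ (fun k => wmul 'X^k (whorner (T : {poly _})`_k L0R)) hm).
rewrite big_mkcond; apply: eq_bigr => k _; rewrite whornerE wmulE dWXn.
by case: ltnP => // h; rewrite nth_default // raddf0 mulr0.
Qed.

Fact flat_additive : zmod_morphism flat.
Proof.
move=> T S; pose m := maxn (size (T : {poly _})) (size (S : {poly _})).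
rewrite !(@flatE m) ?leq_maxl ?leq_maxr //; last first.
  by rewrite (leq_trans (size_polyD _ _)) // size_polyN.
rewrite -sumrB; apply: eq_bigr => i _.
by rewrite -mulrBr -rmorphB /= -coefB.
Qed.
HB.instance Definition _ := GRing.isZmodMorphism.Build _ _ flat flat_additive.

Lemma flat_monom p k : flat (cW p * dW ^+ k) = dW ^+ k * ev p.
Proof.
have -> : cW p * dW ^+ k = p *: 'X^k :> {poly {poly C}}.
  by rewrite dWXn [LHS](ore_mulCl (@derivD C) (@derivM C)) mul_polyC.
have h : (size (p *: 'X^k : {poly {poly C}}) <= k.+1)%N.
  by rewrite (leq_trans (size_scale_leq _ _)) // size_polyXn.
rewrite (@flatE k.+1) // big_ord_recr /= big1 ?add0r.
  by rewrite coefZ coefXn eqxx mulr1.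
move=> i _; rewrite coefZ coefXn (ltn_eqF (ltn_ord i)) mulr0.
by rewrite raddf0 mulr0.
Qed.

Lemma flat_cW p : flat (cW p) = ev p.
Proof. by have := flat_monom p 0; rewrite !expr0 mul1r mulr1. Qed.

Lemma flat_dWX k : flat (dW ^+ k) = dW ^+ k.
Proof. by have := flat_monom 1 k; rewrite !rmorph1 mul1r mulr1. Qed.

Lemma flat_cWM p T : flat (cW p * T) = flat T * ev p.
Proof.
elim/weyl_ind: T => [T S hT hS|q k].
  by rewrite mulrDr !raddfD /= hT hS mulrDl.
by rewrite mulrA -rmorphM !flat_monom -mulrA -rmorphM mulrC.
Qed.

(** The relation [d p = p d + p'] is carried to [p(L0) d = d p(L0) + p'(L0)]. With [flat_cWM] this
    settles the generators needed in [flatM]. *)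
Lemma flat_dWM T : flat (dW * T) = flat T * dW.
Proof.
elim/weyl_ind: T => [T S hT hS|p k].
  by rewrite mulrDr !raddfD /= hT hS mulrDl.
rewrite mulrA dWcW mulrDl -mulrA -exprS raddfD /= !flat_monom.
by rewrite exprSr -!mulrA -mulrDr evalL0_dW.
Qed.

Lemma flatM S T : flat (S * T) = flat T * flat S.
Proof.
elim/weyl_ind: S => [U S hT hS|p k].
  by rewrite mulrDl !raddfD /= hT hS mulrDr.
rewrite -mulrA flat_cWM flat_monom mulrA; congr (_ * _).
elim: k => [|k IH]; first by rewrite !mul1r mulr1.
by rewrite exprS -mulrA flat_dWM IH -mulrA -exprSr exprS.
Qed.

(** The terms in [dW] are fixed and [x] becomes [L0], so the [dW] terms cancel and [x] is left. *)
Lemma flat_L0 : flat L0R = cW 'X.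
Proof.
have hs : flat (\sum_(1 <= k < r.-1) cstW (a k) * dW ^+ k) =
    \sum_(1 <= k < r.-1) cstW (a k) * dW ^+ k.
  rewrite raddf_sum /=; apply: eq_bigr => k _.
  by rewrite [LHS]flat_monom evalWC cstW_comm.
rewrite [in LHS]L0E !raddfB /= flat_dWX flat_cW evalWX hs [in X in _ - X = _]L0E.
by rewrite opprB addrCA subrr addr0.
Qed.

Lemma flat_ev p : flat (ev p) = cW p.
Proof.
elim/poly_lin_ind: p => [c|p q hp hq|p hp].
- by rewrite evalWC flat_cW evalWC.
- by rewrite !rmorphD raddfD /= hp hq.
by rewrite !rmorphM /= evalWX flatM flat_L0 hp -!rmorphM mulrC.
Qed.

Lemma flatK T : flat (flat T) = T.
Proof.
elim/weyl_ind: T => [T S hT hS|p k]; first by rewrite !raddfD /= hT hS.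
by rewrite flat_monom flatM flat_ev flat_dWX.
Qed.

(** This is [ore_left] for [flat S], transported back through the involution. *)
Lemma ore_ev (q : {poly C}) (S : weylR) :
  exists M, exists S', S * ev (q ^+ M) = ev q * S'.
Proof.
have [M [S' h]] := ore_left q (flat S) 1; exists M, (flat S').
by have := congr1 flat h; rewrite !flatM flatK !flat_cW expr1.
Qed.

End Flat.

(** * Differential operators acting on functions *)

Section Analysis.
Import numFieldNormedType.Exports.
Variable R : realType.
Local Notation C := (Cplx R).
Local Notation fn := (cfun R).
Local Notation weylR := (weylR R).
Local Notation dW := (dW R).
Implicit Types (u v : fn) (U : set C^o) (x : C).

(** The scalars are complex, so derivability in direction 1 is complex differentiability. *)
Definition drv u x := derivable (u : C^o -> C^o) x 1.

Lemma dern1E u x : dern 1 u x = derive (u : C^o -> C^o) x 1.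
Proof. exact: derive1E. Qed.

Lemma dernD m k u : dern m (dern k u) = dern (m + k) u.
Proof. exact/esym/iterD. Qed.

Lemma drv_add u v x : drv u x -> drv v x ->
  drv (fun y => u y + v y) x /\ dern 1 (fun y => u y + v y) x = dern 1 u x + dern 1 v x.
Proof.
move=> du dv.
have h1 := @derivableD C C^o C^o u v x 1 du dv.
have h2 := @deriveD C C^o C^o u v x 1 du dv.
split; first exact: h1.
rewrite !dern1E.
exact: h2.
Qed.

Lemma drv_mul u v x : drv u x -> drv v x ->
  drv (fun y => u y * v y) x /\
  dern 1 (fun y => u y * v y) x = u x * dern 1 v x + dern 1 u x * v x.
Proof.
move=> du dv.
have h1 := @derivableM C C^o u v x 1 du dv.
have h2 := @deriveM C C^o u v x 1 du dv.
split; first exact: h1.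
rewrite !dern1E.
rewrite [X in _ = _ + X]mulrC; exact: h2.
Qed.

Lemma drv_cst (c : C) x : drv (fun=> c) x /\ dern 1 (fun=> c) x = 0.
Proof.
split; first exact: (@derivable_cst C C^o C^o c x 1).
by rewrite dern1E; exact: (@derive_cst C C^o C^o c x 1).
Qed.

Lemma drv_horner (p : {poly C}) x :
  drv (horner p) x /\ dern 1 (horner p) x = p^`().[x].
Proof.
elim/poly_lin_ind: p => [c|p q [dp hp] [dq hq]|p [dp hp]].
- have -> : horner c%:P = (fun=> c) by apply/funext => y; rewrite hornerC.
  by rewrite derivC horner0; exact: drv_cst.
- have -> : horner (p + q) = (fun y => p.[y] + q.[y]) by apply/funext => y; rewrite hornerD.
  have [d1 d2] := drv_add dp dq; split; first exact: d1.
  by rewrite derivD hornerD -hp -hq -d2.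
have -> : horner (p * 'X) = (fun y => p.[y] * y).
  by apply/funext => y; rewrite hornerMX.
have di : drv (fun y => y) x := @derivable_id C C^o x 1.
have [d1 d2] := drv_mul dp di; split => //.
rewrite d2 dern1E [derive _ _ _](@derive_id C C^o x 1) derivM derivX mulr1 hp hornerD hornerMX.
by rewrite mulr1 addrC.
Qed.

Lemma drv_inv u x : u x != 0 -> drv u x ->
  drv (fun y => (u y)^-1) x /\ dern 1 (fun y => (u y)^-1) x = - (u x) ^- 2 * dern 1 u x.
Proof.
move=> u0 du.
have h1 := @derivableV C C^o u x 1 u0 du.
have h2 := @deriveV C C^o u x 1 u0 du.
by split; rewrite ?dern1E; [exact: h1|exact: h2].
Qed.

Lemma dern_eq_on U u v : open U -> (forall y, U y -> u y = v y) ->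
  forall k y, U y -> dern k u y = dern k v y.
Proof.
move=> oU h; elim=> [|k IH] y Uy; first exact: h.
rewrite -!(dernD 1 k) !dern1E; apply: (@near_eq_derive C C^o C^o).
exact: filterS IH (open_nbhs_nbhs (conj oU Uy)).
Qed.

Lemma drv_eq_on U u v : open U -> (forall y, U y -> u y = v y) ->
  forall x, U x -> drv u x -> drv v x.
Proof.
move=> oU h x Ux; apply: (@near_eq_derivable C C^o C^o).
exact: filterS h (open_nbhs_nbhs (conj oU Ux)).
Qed.

(** Functions divided by a polynomial are handled on the open set where it does not vanish. *)
Definition smooth_on U u := forall k x, U x -> drv (dern k u) x.

Lemma smooth_onT u : smooth u -> smooth_on setT u.
Proof. by move=> h k x _; exact: h. Qed.

Lemma wactE m (T : weylR) u x : (size (T : {poly _}) <= m)%N ->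
  wact T u x = \sum_(k < m) ((T : {poly _})`_k).[x] * dern k u x.
Proof.
move=> hm; rewrite /wact.
rewrite (big_ord_widen _ (fun k => ((T : {poly _})`_k).[x] * dern k u x) hm).
rewrite big_mkcond; apply: eq_bigr => k _.
by case: ltnP => // h; rewrite nth_default // horner0 mul0r.
Qed.

Lemma wactD (T S : weylR) u x : wact (T + S) u x = wact T u x + wact S u x.
Proof.
pose m := maxn (size (T : {poly _})) (size (S : {poly _})).
rewrite !(@wactE m) ?leq_maxl ?leq_maxr ?size_polyD // -big_split /=.
by apply: eq_bigr => k _; rewrite coefD hornerD mulrDl.
Qed.

Lemma wact0 u x : wact (0 : weylR) u x = 0.
Proof. by apply: (addrI (wact (0 : weylR) u x)); rewrite -wactD !addr0. Qed.

Lemma wact_cWM p (T : weylR) u x : wact (cW p * T) u x = p.[x] * wact T u x.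
Proof.
rewrite (@wactE (size (T : {poly _}))); last first.
  rewrite [cW p * T](ore_mulCl (@derivD C) (@derivM C)) mul_polyC.
  exact: size_scale_leq.
by rewrite mulr_sumr; apply: eq_bigr => k _; rewrite coefcW hornerM mulrA.
Qed.

Lemma wact_dWX k u x : wact (dW ^+ k) u x = dern k u x.
Proof.
have h : (size (dW ^+ k : {poly _}) <= k.+1)%N by rewrite dWXn size_polyXn.
rewrite (wactE _ _ h) dWXn big_ord_recr /= coefXn eqxx hornerC mul1r big1 ?add0r //.
by move=> i _; rewrite coefXn (ltn_eqF (ltn_ord i)) horner0 mul0r.
Qed.

Lemma wact1 u : wact (1 : weylR) u = u.
Proof. by apply/funext => x; rewrite (wact_dWX 0). Qed.

Lemma wact_cW p u x : wact (cW p) u x = p.[x] * u x.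
Proof. by rewrite -[cW p]mulr1 wact_cWM wact1. Qed.

Lemma wactN (T : weylR) u x : wact (- T) u x = - wact T u x.
Proof. by apply: (addrI (wact T u x)); rewrite -wactD !subrr wact0. Qed.

Lemma wact_sum (I : Type) (s : seq I) (P : pred I) (F : I -> weylR) u x :
  wact (\sum_(i <- s | P i) F i) u x = \sum_(i <- s | P i) wact (F i) u x.
Proof. exact: (big_morph (fun T : weylR => wact T u x) (fun T S => wactD T S u x) (wact0 u x)). Qed.

Lemma drv_wact (S : weylR) u x : (forall k, drv (dern k u) x) ->
  drv (wact S u) x /\ dern 1 (wact S u) x = wact (dW * S) u x.
Proof.
move=> su; elim/weyl_ind: S => [T S [dT hT] [dS hS]|p k].
  have -> : wact (T + S) u = (fun y => wact T u y + wact S u y).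
    by apply/funext => y; rewrite wactD.
  have [d1 d2] := drv_add dT dS; split; first exact: d1.
  by rewrite d2 hT hS mulrDr wactD.
have -> : wact (cW p * dW ^+ k) u = (fun y => p.[y] * dern k u y).
  by apply/funext => y; rewrite wact_cWM wact_dWX.
have [dp hp] := drv_horner p x.
have [d1 d2] := drv_mul dp (su k); split; first exact: d1.
rewrite d2 hp mulrA dWcW mulrDl wactD -mulrA -exprS !wact_cWM !wact_dWX.
by rewrite -(dernD 1 k).
Qed.

Lemma wact_dWX_on U (S : weylR) u : open U -> smooth_on U u ->
  forall k x, U x -> dern k (wact S u) x = wact (dW ^+ k * S) u x.
Proof.
move=> oU su; elim=> [|k IH] x Ux; first by rewrite mul1r.
rewrite -(dernD 1 k) exprS -mulrA.
rewrite (dern_eq_on oU (v := wact (dW ^+ k * S) u)) //.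
by have [] := @drv_wact (dW ^+ k * S) u x (fun k => su k x Ux).
Qed.

Lemma smooth_on_wact U (S : weylR) u : open U -> smooth_on U u ->
  smooth_on U (wact S u).
Proof.
move=> oU su k x Ux.
apply: (@drv_eq_on U (wact (dW ^+ k * S) u)) => //.
  by move=> y Uy; rewrite (wact_dWX_on _ oU).
by have [] := @drv_wact (dW ^+ k * S) u x (fun k => su k x Ux).
Qed.

Lemma wactM_on U (T S : weylR) u : open U -> smooth_on U u ->
  forall x, U x -> wact (T * S) u x = wact T (wact S u) x.
Proof.
move=> oU su x Ux; elim/weyl_ind: T => [T1 T2 h1 h2|p k].
  by rewrite mulrDl !wactD h1 h2.
by rewrite -mulrA !wact_cWM wact_dWX (wact_dWX_on _ oU).
Qed.

Lemma smooth_wact (S : weylR) u : smooth u -> smooth (wact S u).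
Proof.
move=> /smooth_onT su k x.
have h := @smooth_on_wact setT S u openT su k x I; exact: h.
Qed.

Lemma wactM (T S : weylR) u x : smooth u -> wact (T * S) u x = wact T (wact S u) x.
Proof. by move=> /smooth_onT su; exact: (wactM_on _ _ (@openT C^o) su). Qed.

Lemma wact_eq_on U (T : weylR) u v : open U -> (forall y, U y -> u y = v y) ->
  forall x, U x -> wact T u x = wact T v x.
Proof.
move=> oU h x Ux; apply: eq_bigr => k _; congr (_ * _).
exact: dern_eq_on Ux.
Qed.

Lemma dern_lin (c : C) u v : smooth u -> smooth v ->
  forall k, dern k (fun y => c * u y + v y) = (fun y => c * dern k u y + dern k v y).
Proof.
move=> su sv; elim=> [|k IH] //; rewrite -(dernD 1 k) IH; apply/funext => y.
have [d1 h1] := drv_cst c y.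
have [d2 h2] := drv_mul d1 (su k y).
have [_ ->] := drv_add d2 (sv k y).
by rewrite h2 h1 mul0r addr0 !(dernD 1 k).
Qed.

Lemma wact_lin (T : weylR) (c : C) u v x : smooth u -> smooth v ->
  wact T (fun y => c * u y + v y) x = c * wact T u x + wact T v x.
Proof.
move=> su sv; rewrite /wact mulr_sumr -big_split /=; apply: eq_bigr => k _.
by rewrite dern_lin // mulrDr mulrCA.
Qed.

Lemma dern1_shift u z x : dern 1 (fun y => u (y + z)) x = dern 1 u (x + z).
Proof.
rewrite /dern /= /derive1; set f := (fun _ => _); set g := (fun _ => _).
suff -> : f = g by [].
by apply/funext => h; rewrite /f /g /= addrA.
Qed.

Lemma dern_shift k u z : dern k (fun y => u (y + z)) = (fun y => dern k u (y + z)).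
Proof.
elim: k => [|k IH]; first by [].
apply/funext => y; transitivity (dern 1 (fun t => dern k u (t + z)) y).
  exact: (congr1 (fun v => dern 1 v y) IH).
exact: dern1_shift.
Qed.

Lemma drv_shift u z x : drv u (x + z) -> drv (fun y => u (y + z)) x.
Proof.
rewrite /drv /derivable; set f := (fun _ => _); set g := (fun _ => _).
suff -> : f = g by [].
by apply/funext => h; rewrite /f /g /= addrA.
Qed.

Lemma smooth_shift u z : smooth u -> smooth (fun y => u (y + z)).
Proof. by move=> su k x; rewrite dern_shift; apply: drv_shift; exact: su. Qed.

Lemma dern_horner (p : {poly C}) k : dern k (horner p) = horner p^`(k).
Proof.
elim: k => [|k IH] //; rewrite -(dernD 1 k) IH derivnS; apply/funext => x.
exact: (drv_horner _ x).2.
Qed.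

Lemma smooth_horner (p : {poly C}) : smooth (horner p).
Proof. by move=> k x; rewrite dern_horner; exact: (drv_horner _ x).1. Qed.

Definition nonroots (p : {poly C}) : set C^o := [set x | p.[x] != 0]%classic.

Lemma open_nonroots (p : {poly C}) : open (nonroots p).
Proof.
have -> : nonroots p = ((horner p : C^o -> C^o) @^-1` (~` [set 0]))%classic.
  by apply/seteqP; split=> x /= /eqP.
apply: open_comp.
  move=> x _; apply: differentiable_continuous.
  by apply/derivable1_diffP; exact: (drv_horner p x).1.
apply: closed_openC; apply: accessible_closed_set1.
by apply: hausdorff_accessible; exact: norm_hausdorff.
Qed.

End Analysis.

(** * Eigenfunctions and Wronskians *)

Lemma horner_eq0P (F : numFieldType) (p : {poly F}) : (forall x, p.[x] = 0) -> p = 0.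
Proof.
move=> h; apply/eqP; apply: contraT => p0.
pose s : seq F := [seq i%:R | i <- iota 0 (size p)].
have us : uniq s by rewrite map_inj_uniq ?iota_uniq //; apply: mulrIn; exact: oner_neq0.
have := max_poly_roots p0 _ us; rewrite size_map size_iota ltnn => -> //.
by apply/allP => y _; rewrite /root h.
Qed.

(** The powers of ['X - x%:P] serve as test functions: up to factorials, their jets at [x] are dual
    to the derivatives there. *)
Lemma derivn_XsubC_exp (F : comNzRingType) (x : F) k i :
  ((('X - x%:P) ^+ k)^`(i)).[x] = (k`!)%:R *+ (i == k).
Proof.
elim: k i => [|k IH] [|i].
- by rewrite expr0 derivn0 hornerC.
- by rewrite expr0 derivSn -polyC1 derivC derivnC; case: i => [|i]; rewrite hornerC.
- by rewrite derivn0 exprS hornerM hornerXsubC subrr mul0r.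
rewrite derivSn deriv_exp derivB derivX derivC subr0 mul1r /= derivnMn hornerMn IH.
by rewrite eqSS factS mulrnAC -[_%:R *+ k.+1]mulrnA mulnC.
Qed.

Section Eigenfunctions.
Variable R : realType.
Local Notation C := (Cplx R).
Local Notation fn := (cfun R).
Local Notation weylR := (weylR R).
Local Notation dW := (dW R).
Variables (r : nat) (a : nat -> C).
Local Notation L0 := (L0R r a).
Local Notation ev := (evalW L0).
Implicit Types (g : fn) (x z : C).

Definition hat g z : fn := fun y => g (y + z).

Lemma smooth_hat g z : inkerL0 r a g -> smooth (hat g z).
Proof. by case=> sg _; exact: smooth_shift. Qed.

(** Shifting the argument by [z] affects [L0] only in its coefficient [x], which becomes [x + z]. *)
Lemma wact_L0_hat g z x : inkerL0 r a g -> wact L0 (hat g z) x = z * hat g z x.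
Proof.
case=> sg hg; rewrite L0E !wactD !wactN wact_dWX wact_cW hornerX wact_sum.
rewrite dern_shift hg mulrDl.
have -> : \sum_(1 <= k < r.-1) wact (cstW (a k) * dW ^+ k) (hat g z) x =
  \sum_(1 <= k < r.-1) a k * dern k g (x + z).
  apply: eq_bigr => k _; rewrite wact_cWM hornerC wact_dWX.
  by rewrite dern_shift.
by rewrite /hat [X in X - _ - _]addrC addrK addrAC subrr add0r.
Qed.

Lemma wact_ev_hat p g z x : inkerL0 r a g -> wact (ev p) (hat g z) x = p.[z] * hat g z x.
Proof.
move=> kg; elim/poly_lin_ind: p x => [c|p q hp hq|p hp] x.
- by rewrite evalWC wact_cW !hornerC.
- by rewrite rmorphD wactD hp hq hornerD mulrDl.
rewrite rmorphM /= evalWX wactM; last exact: smooth_hat.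
have -> : wact L0 (hat g z) = (fun y => z * hat g z y + (fun=> 0) y).
  by apply/funext => y; rewrite wact_L0_hat // addr0.
rewrite wact_lin; last 2 first.
- exact: smooth_hat.
- have -> : (fun=> 0) = horner (0 : {poly C}) by apply/funext => y; rewrite horner0.
  exact: smooth_horner.
rewrite hp hornerMX [X in _ + X](_ : _ = 0) ?addr0 ?mulrA 1?[z * _]mulrC //.
have -> : (fun=> 0) = wact (0 : weylR) (hat g z) by apply/funext => y; rewrite wact0.
by rewrite -wactM ?mulr0 ?wact0 //; exact: smooth_hat.
Qed.

Definition chat g (l c : C) : fn := fun x => dern 1 g (x + l) + c * g (x + l).

Lemma chatE g l c : chat g l c = wact (dW + cstW c) (hat g l).
Proof.
apply/funext => x; rewrite wactD wact_cW hornerC -[dW]expr1 wact_dWX.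
by rewrite dern_shift.
Qed.

Lemma smooth_chat g l c : inkerL0 r a g -> smooth (chat g l c).
Proof. by move=> kg; rewrite chatE; apply/smooth_wact/smooth_hat. Qed.

(** Moving [p(L0)] past [d + c] costs [p'(L0)], and both then act on [hat g l] by scalars. *)
Lemma wact_ev_chat p g l c x : inkerL0 r a g ->
  wact (ev p) (chat g l c) x = p.[l] * chat g l c x + p^`().[l] * hat g l x.
Proof.
move=> kg; have sg := @smooth_hat g l kg; rewrite chatE -wactM //.
rewrite mulrDr evalL0_dW (cstW_comm (ev p)) addrAC -mulrDl [LHS]wactD [X in _ + X = _]wact_ev_hat //.
congr (_ + _); rewrite wactM // (_ : wact (ev p) (hat g l) = wact (cW p.[l]%:P) (hat g l)).
  by rewrite -wactM // [_ * _](cstW_comm) wact_cWM hornerC.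
by apply/funext => y; rewrite wact_ev_hat // wact_cW hornerC.
Qed.

(** For [p(x) d^i] the flat is [d^i p(L0)]. In the variable [z], [p(L0)] multiplies [g(x + z)] by
    [p(x)], and the derivatives of [g(x + z)] in [x] and in [z] agree. *)
Lemma wact_flat (T : weylR) g x z : inkerL0 r a g ->
  wact (flat r a T) (hat g x) z = wact T (hat g z) x.
Proof.
move=> kg; have sg y := @smooth_hat g y kg.
elim/weyl_ind: T => [T S hT hS|p i]; first by rewrite raddfD /= !wactD hT hS.
rewrite flat_monom wactM // wact_cWM.
rewrite (_ : wact (ev p) (hat g x) = wact (cW p.[x]%:P) (hat g x)); last first.
  by apply/funext => y; rewrite wact_ev_hat // wact_cW hornerC.
rewrite -wactM // [_ * _](cstW_comm) wact_cWM hornerC !wact_dWX.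
by rewrite !dern_shift addrC.
Qed.

End Eigenfunctions.

(** * Operators defined by a Wronskian determinant, and division by them *)

Section Wronskian.
Variable R : realType.
Local Notation C := (Cplx R).
Local Notation fn := (cfun R).
Local Notation weylR := (weylR R).
Local Notation dW := (dW R).
Variables (N : nat) (phi : nat -> fn) (kappa : C) (K : weylR).
Hypothesis kappa0 : kappa != 0.
Hypothesis hK : forall u x, wact K u x = kappa * \det (Wrext N phi u x).
Hypothesis smooth_phi : forall j, (j < N)%N -> smooth (phi j).
Local Notation coef k := ((K : {poly {poly C}})`_k).
Local Notation tau := (coef N).
Hypothesis tau0 : tau != 0.

(** [K] is known only through its action, so its coefficients are read off from test functions. *)
Lemma coefK_test k x :
  (coef k).[x] * (k`!)%:R = kappa * \det (Wrext N phi (horner (('X - x%:P) ^+ k)) x).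
Proof.
rewrite -hK (@wactE _ (maxn (size (K : {poly _})) k.+1)) ?leq_maxl //.
have hk : (k < maxn (size (K : {poly _})) k.+1)%N by rewrite leq_max ltnSn orbT.
rewrite (bigD1 (Ordinal hk)) //= dern_horner derivn_XsubC_exp eqxx mulr1n.
rewrite big1 ?addr0 // => i ik; rewrite dern_horner derivn_XsubC_exp.
by rewrite -val_eqE /= in ik; rewrite (negPf ik) mulr0n mulr0.
Qed.

(** For [k > N] the derivatives of the test function of order at most [N] vanish at [x], so the last
    column of the determinant is zero. *)
Lemma size_K : (size (K : {poly {poly C}}) <= N.+1)%N.
Proof.
apply/leq_sizeP => k hk; apply: horner_eq0P => x.
have := coefK_test k x; rewrite (expand_det_col _ ord_max) big1 ?mulr0; last first.
  move=> i _; rewrite mxE /= ltnn dern_horner derivn_XsubC_exp.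
  by rewrite ltn_eqF ?mulr0n ?mul0r // (leq_trans (ltn_ord i)).
by move/eqP; rewrite mulf_eq0 pnatr_eq0 (gtn_eqF (fact_gt0 k)) orbF => /eqP.
Qed.

(** For the test function of degree [N] the last column is zero except for [N!] at the bottom, and
    the determinant reduces to the Wronskian of the [phi]. *)
Lemma tauE x : tau.[x] = kappa * \det (Wr N phi x).
Proof.
apply: (@mulIf _ (N`!)%:R); first by rewrite pnatr_eq0 (gtn_eqF (fact_gt0 N)).
rewrite coefK_test (expand_det_col _ ord_max) (bigD1 ord_max) //= big1 ?addr0; last first.
  move=> i im; rewrite mxE /= ltnn dern_horner derivn_XsubC_exp.
  by rewrite -val_eqE /= in im; rewrite (negPf im) mulr0n mul0r.
rewrite mxE /= ltnn dern_horner derivn_XsubC_exp eqxx mulr1n -mulrA [_ * N`!%:R]mulrC.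
congr (_ * (_ * _)); rewrite /cofactor -signr_odd oddD addbb expr0 mul1r.
congr (\det _); apply/matrixP => i j; rewrite !mxE !lift_max.
by rewrite ltn_ord.
Qed.

Lemma wact_K_phi j x : (j < N)%N -> wact K (phi j) x = 0.
Proof.
move=> hj; rewrite hK -det_tr.
have hj' : (j < N.+1)%N by exact: leqW.
rewrite (@determinant_alternate _ _ _ (Ordinal hj') ord_max) ?mulr0 //.
  by rewrite -val_eqE /= ltn_eqF.
by move=> i; rewrite !mxE /= hj ltnn.
Qed.

Lemma Wr_unit x : tau.[x] != 0 -> Wr N phi x \in unitmx.
Proof.
by rewrite tauE mulf_eq0 (negPf kappa0) /= unitmxE unitfE.
Qed.

Lemma Wr_row0 x (v : nat -> C) : tau.[x] != 0 ->
  (forall j, (j < N)%N -> \sum_(k < N) v k * dern k (phi j) x = 0) ->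
  forall k, (k < N)%N -> v k = 0.
Proof.
move=> tx h k hk; pose V := \row_(i < N) v i.
have V0 : V *m Wr N phi x = 0.
  apply/rowP => j; rewrite !mxE -[RHS](h j (ltn_ord j)); apply: eq_bigr => i _.
  by rewrite !mxE.
have : V = 0 by rewrite -(mulmxK (Wr_unit tx) V) V0 mul0mx.
by move=> /rowP /(_ (Ordinal hk)); rewrite !mxE.
Qed.

Lemma Wr_interp x (b : nat -> C) : tau.[x] != 0 ->
  exists c : nat -> C, forall k, (k < N)%N ->
    \sum_(j < N) c j * dern k (phi j) x = b k.
Proof.
move=> tx; pose V := invmx (Wr N phi x) *m \col_(i < N) b i.
exists (fun j => if insub j is Some j' then V j' 0 else 0) => k hk.
have := mulKVmx (Wr_unit tx) (\col_(i < N) b i); rewrite -/V.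
move=> /colP /(_ (Ordinal hk)); rewrite !mxE => <-; apply: eq_bigr => j _.
by rewrite valK !mxE mulrC.
Qed.

(** Division with remainder by [K], whose leading coefficient [tau] need not be invertible: each
    reduction step multiplies by one more [tau]. *)
Lemma pseudo_div (T : weylR) : exists m, exists Q Rm : weylR,
  cW (tau ^+ m) * T = Q * K + Rm /\ (size (Rm : {poly {poly C}}) <= N)%N.
Proof.
move: {2}(size _) (leqnn (size (T : {poly {poly C}}))) => s.
elim: s T => [|s IH] T hT.
  exists 0%N, 0, T; split; last exact: (leq_trans hT).
  have E : cW (tau ^+ 0) * T = T by rewrite expr0 rmorph1 (mul1r T).
  apply: (etrans E); apply: esym.
  by apply: (etrans (congr1 (fun S => S + T) (mul0r K))); exact: add0r.
have [hs|hs] := leqP (s.+1) N.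
  exists 0%N, 0, T; split; last exact: (leq_trans hT).
  have E : cW (tau ^+ 0) * T = T by rewrite expr0 rmorph1 (mul1r T).
  apply: (etrans E); apply: esym.
  by apply: (etrans (congr1 (fun S => S + T) (mul0r K))); exact: add0r.
(* The top coefficient of [A K] is [t tau], which cancels that of [tau T]. *)
pose t := (T : {poly {poly C}})`_s; pose A := cW t * dW ^+ (s - N).
have sX : (size (A : {poly {poly C}}) <= (s - N).+1)%N.
  rewrite /A dWXn [cW t * _](ore_mulCl (@derivD C) (@derivM C)) mul_polyC.
  by rewrite (leq_trans (size_scale_leq _ _)) // size_polyXn.
have cX : (A : {poly {poly C}})`_(s - N) = t.
  by rewrite /A coefcW dWXn coefXn eqxx mulr1.
have hsN : (s - N + N)%N = s by rewrite subnK.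
have [|m [Q [Rm [h hR]]]] := IH (cW tau * T - A * K).
  apply/leq_sizeP => j hj; rewrite coefB coefcW.
  have [->|js] := eqVneq j s.
    rewrite -[in X in _ - X]hsN [X in _ - X](coef_ore_mul (@derivD C) (@derivM C)) ?size_K //.
    by rewrite cX -/t mulrC subrr.
  have js' : (s < j)%N by rewrite ltn_neqAle eq_sym js.
  have /leq_sizeP -> // := hT; rewrite mulr0 sub0r.
  have /leq_sizeP := size_ore_mul (@derivD C) (@derivM C) sX size_K.
  by rewrite hsN => -> //; rewrite oppr0.
exists m.+1, (Q + cW (tau ^+ m) * A), Rm; split => //.
by rewrite mulrDl addrAC -h mulrBr exprSr rmorphM /= !mulrA subrK.
Qed.

(** The remainder of [pseudo_div] has order below [N] and kills all [phi]. Invertibility of the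
    Wronskian matrix makes its coefficients vanish wherever [tau] does not, hence identically. *)
Lemma kills_phi_div (T : weylR) :
  (forall j x, (j < N)%N -> wact T (phi j) x = 0) ->
  exists m, exists Q : weylR, cW (tau ^+ m) * T = Q * K.
Proof.
move=> hT; have [m [Q [Rm [h hR]]]] := pseudo_div T; exists m, Q.
rewrite h; apply: (addrI (- (Q * K))); rewrite addKr addNr.
have R0 j x : (j < N)%N -> wact Rm (phi j) x = 0.
  move=> hj; have -> : Rm = cW (tau ^+ m) * T - Q * K by rewrite h addrAC subrr add0r.
  rewrite wactD wactN wact_cWM hT // mulr0 add0r wactM; last exact: smooth_phi.
  rewrite (_ : wact K (phi j) = wact (0 : weylR) (phi j)); last first.
    by apply/funext => y; rewrite wact_K_phi // wact0.
  by rewrite -wactM ?mulr0 ?wact0 ?oppr0 //; exact: smooth_phi.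
apply/polyP => k; rewrite coef0; have [hk|hk] := leqP N k.
  by rewrite nth_default // (leq_trans hR).
apply/eqP; have /eqP : tau * (Rm : {poly {poly C}})`_k = 0.
  apply: horner_eq0P => x; rewrite hornerM; have [->|tx] := eqVneq tau.[x] 0.
    by rewrite mul0r.
  rewrite (Wr_row0 (v := fun k => ((Rm : {poly {poly C}})`_k).[x]) tx) ?mulr0 //.
  by move=> j hj; rewrite -wactE // R0.
by rewrite mulf_eq0 (negPf tau0).
Qed.

End Wronskian.

(** * Conjugated operators *)

Section Denominators.
Variable R : realType.
Local Notation C := (Cplx R).
Local Notation weylR := (weylR R).
Local Notation DopR := (DopR R).

(** The product of the chosen denominators, rather than a least common multiple, is nonzero exactly
    where every coefficient is regular in the sense of [Dregular]. *)
Definition denD (Q : DopR) : {poly C} :=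
  \prod_(i < size (Q : {poly _})) (frac (repr (Q : {poly _})`_i)).2.

Definition numD (Q : DopR) : weylR :=
  \poly_(i < size (Q : {poly _})) ((frac (repr (Q : {poly _})`_i)).1 *
    \prod_(j < size (Q : {poly _}) | j != i :> nat) (frac (repr (Q : {poly _})`_j)).2).

Lemma denD_neq0 Q : denD Q != 0.
Proof. by apply/prodf_neq0 => i _; exact: ratf_denP. Qed.

Lemma denDE Q : cD (tofracC (denD Q)) * Q = toDr (numD Q).
Proof.
apply/polyP => i; rewrite coefcD coef_map coef_poly /=.
case: ltnP => hi; last by rewrite nth_default // mulr0 rmorph0.
rewrite /denD (bigD1 (Ordinal hi)) //= !rmorphM /= mulrAC [_ * _`_i]mulrC ratfE.
by congr (_ * tofracC _); apply: eq_bigl => j; rewrite -val_eqE.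
Qed.

Lemma denD_regular Q x : Dregular Q x -> (denD Q).[x] != 0.
Proof.
by move=> h; rewrite horner_prod; apply/prodf_neq0 => i _; exact: h.
Qed.

Lemma Dact_den Q u x : Dregular Q x -> (denD Q).[x] * Dact Q u x = wact (numD Q) u x.
Proof.
move=> h; rewrite (@wactE _ (size (Q : {poly _}))) ?size_poly // /Dact mulr_sumr.
apply: eq_bigr => i _; rewrite mulrA coef_poly ltn_ord; congr (_ * _).
rewrite /denD (bigD1 i) //= !hornerM /feval [LHS]mulrC mulrA; congr (_ * _.[x]).
by rewrite divfK //; exact: h.
Qed.

End Denominators.

Section Quotients.
Variable R : realType.
Local Notation C := (Cplx R).
Local Notation fn := (cfun R).

(** The derivative [(s w' - s' w) / s^2] has the same shape with denominator [s^2], so the induction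
    runs over all [s] and [w]. *)
Lemma smooth_on_div (s : {poly C}) (w : fn) : smooth w ->
  smooth_on (nonroots s) (fun y => w y * (s.[y])^-1).
Proof.
move=> sw k; elim: k s w sw => [|k IH] s w sw x sx.
  have [d1 _] := drv_inv sx (drv_horner s x).1.
  by have [d2 _] := drv_mul (sw 0%N x) d1; exact: d2.
have sx2 : nonroots (s ^+ 2) x by rewrite /nonroots /= horner_exp expf_neq0.
pose w2 := wact (cW s * dW R - cW s^`()) w.
have sw2 : smooth w2 by exact: smooth_wact.
have eq1 y : nonroots s y ->
    w2 y * ((s ^+ 2).[y])^-1 = dern 1 (fun y => w y * (s.[y])^-1) y.
  move=> sy; have [d1 h1] := drv_inv sy (drv_horner s y).1.
  have [_ ->] := drv_mul (sw 0%N y) d1.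
  rewrite h1 (drv_horner s y).2 /w2 wactD wactN wact_cWM wact_cW horner_exp.
  rewrite -[dW R]expr1 wact_dWX mulrBl addrC; congr (_ + _).
    by rewrite [in RHS]mulNr mulrN -mulrA [s^`().[y] * _]mulrC -mulrA.
  by rewrite expr2 invfM mulrA [s.[y] * _]mulrC mulfK.
have := @drv_eq_on R (nonroots s) _ _ (@open_nonroots R s)
  (@dern_eq_on R _ _ _ (@open_nonroots R s) eq1 k) x sx (IH _ _ sw2 x sx2).
by rewrite dernD addn1.
Qed.

End Quotients.

(** * Clearing denominators, and the eigenvalue equation for conjugated operators *)

Section Bispectrality.
Variable R : realType.
Local Notation C := (Cplx R).
Local Notation fn := (cfun R).
Local Notation weylR := (weylR R).
Local Notation DopR := (DopR R).
Local Notation dW := (dW R).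
Variables (r : nat) (a : nat -> C).
Local Notation L0 := (L0R r a).
Local Notation ev := (evalW L0).

Lemma RTLE (T : weylR) p :
  RTL T (L0w r a) p <-> exists Q : DopR, toDr (T * ev p) = Q * toDr T.
Proof. by rewrite /RTL; split=> -[Q h]; exists Q; move: h; rewrite whornerE. Qed.

Lemma tofrac_neq0 (q : {poly C}) : q != 0 -> tofracC q != 0.
Proof. by rewrite tofracC_eq0. Qed.

Lemma cDK (q : {poly C}) (T : DopR) : q != 0 ->
  cD (tofracC q)^-1 * (cD (tofracC q) * T) = T.
Proof.
move=> q0; rewrite mulrA -rmorphM mulVf ?tofrac_neq0 //.
by rewrite rmorph1 (mul1r T).
Qed.

Lemma cDVK (q : {poly C}) (T : DopR) : q != 0 ->
  cD (tofracC q) * (cD (tofracC q)^-1 * T) = T.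
Proof.
move=> q0; rewrite mulrA -rmorphM mulfV ?tofrac_neq0 //.
by rewrite rmorph1 (mul1r T).
Qed.

(** Together with [RTL_clear], this turns membership into an identity in the Weyl algebra, up to a
    polynomial factor on the left. *)
Lemma RTL_of (T Q : weylR) p q : q != 0 ->
  cW q * (T * ev p) = Q * T -> RTL T (L0w r a) p.
Proof.
move=> q0 h; apply/RTLE; exists (cD (tofracC q)^-1 * toDr Q).
by rewrite -mulrA -rmorphM -h /= [toDr (cW q * _)]rmorphM /= toDr_cW cDK.
Qed.

Lemma RTL_clear (T : weylR) p : RTL T (L0w r a) p ->
  exists q, exists Q : weylR, q != 0 /\ cW q * (T * ev p) = Q * T.
Proof.
move=> /RTLE [Q h]; exists (denD Q), (numD Q); split; first exact: denD_neq0.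
by apply: toDr_inj; rewrite rmorphM /= toDr_cW h mulrA denDE rmorphM.
Qed.

(** The operator [Q] with [T p(L0) = Q T] only has to be conjugated by [t]. *)
Lemma conj_exists (T : weylR) t p : t != 0 -> RTL T (L0w r a) p ->
  exists Q : DopR, Q * (cD (tofracC t)^-1 * toDr T) =
    (cD (tofracC t)^-1 * toDr T) * toDr (ev p).
Proof.
move=> t0 /RTLE [Q h]; exists (cD (tofracC t)^-1 * Q * cD (tofracC t)).
rewrite -[LHS]mulrA [X in _ * X = _](cDVK (toDr T) t0) -[RHS]mulrA.
by rewrite -[toDr T * _](rmorphM (@toDr R)) /= h mulrA.
Qed.

Lemma cancel_scalar (F : fieldType) (c A B D E v : F) : A != 0 ->
  c * (D * E * (B * v)) = A * (D * (E * (B * (c * A^-1 * v)))).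
Proof. by move=> A0; field. Qed.

Lemma comm_cD (b c : ratf R) : GRing.comm (cD b) (cD c).
Proof.
apply: (etrans (esym (rmorphM (@cD R) b c))).
apply: (etrans (congr1 (@cD R) (mulrC b c))).
exact: (rmorphM (@cD R) c b).
Qed.

Lemma toDr_cWMM q (T S : weylR) :
  toDr (cW q * (T * S)) = cD (tofracC q) * (toDr T * toDr S).
Proof.
rewrite (rmorphM (@toDr R) (cW q)) (rmorphM (@toDr R) T S) /=.
exact: (congr1 (fun c => c * (toDr T * toDr S)) (toDr_cW q)).
Qed.

Lemma cD_tofracM (q s : {poly C}) :
  cD (tofracC (q * s)) = cD (tofracC q) * cD (tofracC s).
Proof.
apply: (etrans (congr1 (@cD R) (rmorphM (@tofracC R) q s))).
exact: (rmorphM (@cD R)).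
Qed.

(** Read [tM] as [t^M], [d] and [N] as the common denominator and the numerator of [Q], [X] as
    [t^-1 T], and [E] as [p(L0)]. *)
Lemma conj_shuffle (D : pzRingType) (t tM d Q Q2 N X E : D) :
  GRing.comm t tM -> GRing.comm t d ->
  tM * N = Q2 * t -> d * Q = N -> Q * X = X * E ->
  t * (Q2 * (t * X)) = (tM * d) * ((t * X) * E).
Proof.
move=> c1 c2 e1 e2 e3; rewrite (mulrA Q2) -e1 -e2 -!mulrA e3.
by rewrite mulrA c1 -!mulrA (mulrA t) c2 -!mulrA.
Qed.

(** The general [T], [t] and [c] serve both variables: [Kb] with [tau] in [x], its flat with [af] in
    [z]. Once denominators are cleared, an identity in the Weyl algebra is applied to [hat g l], on
    which [p(L0)] acts by [p.[l]]. *)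
Lemma conj_action (T : weylR) t p (Q : DopR) g l c u x : t != 0 ->
  Q * (cD (tofracC t)^-1 * toDr T) = (cD (tofracC t)^-1 * toDr T) * toDr (ev p) ->
  inkerL0 r a g -> t.[x] != 0 -> Dregular Q x ->
  (forall y, u y = c * (t.[y])^-1 * wact T (hat g l) y) ->
  Dact Q u x = p.[l] * u x.
Proof.
move=> t0 hQ kg tx rQ hu.
(* The numerator of [Q] is rewritten with [t] on its right, where it cancels the denominator of
   [u]. *)
have [M [Q2 h2]] := ore_left t (numD Q) 1; rewrite expr1 in h2.
have h3 : cW t * (Q2 * T) = cW (t ^+ M * denD Q) * (T * ev p).
  apply: toDr_inj; pose X := cD (tofracC t)^-1 * toDr T.
  have XE : toDr T = cD (tofracC t) * X by rewrite cDVK.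
  have h4 : cD (tofracC (t ^+ M)) * toDr (numD Q) = toDr Q2 * cD (tofracC t).
    by rewrite -!toDr_cW -!rmorphM h2.
  have h5 : cD (tofracC (denD Q)) * Q = toDr (numD Q) := denDE Q.
  have h6 : GRing.comm (cD (tofracC t)) (cD (tofracC (t ^+ M))) := comm_cD _ _.
  have h7 : GRing.comm (cD (tofracC t)) (cD (tofracC (denD Q))) := comm_cD _ _.
  have h8 : cD (tofracC t) * (toDr Q2 * toDr T) =
      cD (tofracC (t ^+ M)) * cD (tofracC (denD Q)) * (toDr T * toDr (ev p)).
    by rewrite XE; exact: conj_shuffle h6 h7 h4 h5 hQ.
  apply: (etrans (toDr_cWMM t Q2 T)); apply: (etrans h8).
  apply: esym; apply: (etrans (toDr_cWMM _ T (ev p))).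
  exact: (congr1 (fun c => c * (toDr T * toDr (ev p))) (cD_tofracM (t ^+ M) (denD Q))).
pose U := nonroots t; have oU : open U := @open_nonroots R t.
have sg := @smooth_hat _ r a g l kg.
have sv : smooth (wact T (hat g l)) by exact: smooth_wact.
have su : smooth_on U u.
  have -> : u = (fun y => wact (cstW c * T) (hat g l) y * (t.[y])^-1).
    by apply/funext => y; rewrite hu wact_cWM hornerC mulrAC.
  by apply: smooth_on_div; exact: smooth_wact.
have e1 : (denD Q).[x] * Dact Q u x = wact (numD Q) u x by exact: Dact_den.
have e2 : (t ^+ M).[x] * wact (numD Q) u x = c * wact (Q2 * T) (hat g l) x.
  rewrite -wact_cWM h2 (wactM_on _ _ oU su tx).
  rewrite (@wact_eq_on _ U _ _ (wact (cstW c * T) (hat g l)) oU) //; last first.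
    move=> y ty; rewrite wact_cW wact_cWM hornerC hu mulrA [c * _]mulrC.
    by rewrite mulrA mulfV // mul1r.
  by rewrite -wactM // mulrA [Q2 * _]cstW_comm -mulrA wact_cWM hornerC.
have e3 : t.[x] * wact (Q2 * T) (hat g l) x =
    (t ^+ M).[x] * (denD Q).[x] * (p.[l] * wact T (hat g l) x).
  rewrite -wact_cWM h3 wact_cWM hornerM; congr (_ * _).
  rewrite wactM // (_ : wact (ev p) (hat g l) = wact (cstW p.[l]) (hat g l)).
    by rewrite -wactM // [T * _]cstW_comm wact_cWM hornerC.
  by apply/funext => y; rewrite (wact_ev_hat _ _ _ kg) wact_cW hornerC.
have tM : (t ^+ M).[x] != 0 by rewrite horner_exp expf_neq0.
have dx : (denD Q).[x] != 0 by exact: denD_regular.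
apply: (mulfI dx); apply: (mulfI tM); apply: (mulfI tx).
rewrite e1 e2 hu mulrCA e3.
exact: cancel_scalar.
Qed.

End Bispectrality.

(** * The ring R_{K,L0} *)

Lemma double_root (F : comNzRingType) (l : F) (q : {poly F}) :
  ((('X - l%:P) ^+ 2 * q).[l] = 0) * ((('X - l%:P) ^+ 2 * q)^`().[l] = 0).
Proof.
have h0 : ('X - l%:P).[l] = 0 by rewrite hornerXsubC subrr.
move: ('X - l%:P) h0 => s h0; split.
  by rewrite hornerM horner_exp h0 expr0n mul0r.
rewrite derivM deriv_exp /= expr1 hornerD !hornerM hornerMn !hornerM h0.
by rewrite !(mulr0, mul0rn, mul0r, addr0).
Qed.

Section Main.
Variable R : realType.
Local Notation C := (Cplx R).
Local Notation fn := (cfun R).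
Local Notation weylR := (weylR R).
Local Notation dW := (dW R).
Variables (r : nat) (a : nat -> C) (f : nat -> fn) (n : nat) (lam gam : nat -> C).
Variables (kappa : C) (K : weylR).
Hypothesis hr : (1 < r)%N.
Hypothesis hf_ker : forall j, (j < r)%N -> inkerL0 r a (f j).
Hypothesis hf_wr : forall x : C, \det (Wr r f x) = 1.
Hypothesis hn : (0 < n)%N.
Hypothesis hlam : forall i j, (i < n)%N -> (j < n)%N -> lam i = lam j -> i = j.
Hypothesis hkappa : kappa != 0.
Hypothesis hK : forall u x, wact K u x = barK r n f lam gam kappa u x.
Local Notation N := (r * n)%N.
Local Notation tau := ((K : {poly {poly C}})`_N).
Hypothesis tau0 : tau != 0.
Local Notation phi := (phiC r f lam gam).
Local Notation L0 := (L0R r a).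
Local Notation ev := (evalW L0).

Let r0 : (0 < r)%N. Proof. exact: ltnW. Qed.

Lemma phiE k : phi k = chat (f (k %% r)%N) (lam (k %/ r)%N) (gam (k %/ r)%N).
Proof. by []. Qed.

Lemma ker_mod k : inkerL0 r a (f (k %% r)%N).
Proof. by apply: hf_ker; rewrite ltn_mod. Qed.

Lemma div_lt k : (k < N)%N -> (k %/ r < n)%N.
Proof. by rewrite ltn_divLR // mulnC. Qed.

Lemma smooth_phi k : smooth (phi k).
Proof. by rewrite phiE; apply: smooth_chat; exact: ker_mod. Qed.

Lemma wact_ev_phi p k x : wact (ev p) (phi k) x =
  p.[lam (k %/ r)%N] * phi k x +
  p^`().[lam (k %/ r)%N] * hat (f (k %% r)%N) (lam (k %/ r)%N) x.
Proof. by rewrite phiE; apply: wact_ev_chat; exact: ker_mod. Qed.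

Lemma wact_cst_comm (T : weylR) c u x : smooth u ->
  wact T (fun y => c * u y) x = c * wact T u x.
Proof.
move=> su; have -> : (fun y => c * u y) = wact (cstW c) u.
  by apply/funext => y; rewrite wact_cW hornerC.
by rewrite -wactM // [T * _]cstW_comm wact_cWM hornerC.
Qed.

Lemma wact_Kphi k x : (k < N)%N -> wact K (phi k) x = 0.
Proof. by move=> hk; exact: (wact_K_phi hK). Qed.

Lemma phi_div (T : weylR) : (forall j x, (j < N)%N -> wact T (phi j) x = 0) ->
  exists m, exists Q : weylR, cW (tau ^+ m) * T = Q * K.
Proof.
by apply: (kills_phi_div hkappa hK _ tau0) => j _; exact: smooth_phi.
Qed.

(** Under the condition on [p'], each [phi j] with [j < N] is an eigenfunction of [p(L0)], so
    [K p(L0)] kills it and division by [K] applies. *)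
Lemma RTL_of_crit p : (forall i, (i < n)%N -> p^`().[lam i] = 0) -> RTL K (L0w r a) p.
Proof.
move=> hp; have [|m [Q h]] := @phi_div (K * ev p).
  move=> j x hj; rewrite wactM; last exact: smooth_phi.
  have -> : wact (ev p) (phi j) = (fun y => p.[lam (j %/ r)%N] * phi j y).
    by apply/funext => y; rewrite wact_ev_phi hp ?mul0r ?addr0 // div_lt.
  by rewrite wact_cst_comm ?wact_Kphi ?mulr0 //; exact: smooth_phi.
exact: (RTL_of (expf_neq0 m tau0) h).
Qed.

Lemma exists_nonroot (q : {poly C}) : q != 0 -> exists x, q.[x] != 0.
Proof.
move=> q0; apply: contrapT => h; move/eqP: q0; apply; apply: horner_eq0P => x.
by apply/eqP; apply: contrapT => /negP hx; apply: h; exists x.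
Qed.

(* Both [u] and the [phi]'s are annihilated by an operator of order [N] with
   leading coefficient nonzero at [x], so agreement of jets of order [< N]
   propagates to all orders. *)
Lemma jets_agree (q : {poly C}) (u : fn) x : smooth u -> (q * tau).[x] != 0 ->
  (forall y, wact (cW q * K) u y = 0) ->
  exists c : nat -> C, forall (S : weylR),
    wact S u x = \sum_(j < N) c j * wact S (phi j) x.
Proof.
move=> su; rewrite hornerM mulf_eq0 negb_or => /andP[qx tx] hu.
have [c hc] := @Wr_interp _ _ _ _ _ hkappa hK x (fun k => dern k u x) tx.
exists c.
have key k : dern k u x = \sum_(j < N) c j * dern k (phi j) x.
  have [m] := ubnP k; elim: m k => // m IH k; rewrite ltnS => km.
  have [kN|kN] := ltnP k N; first by rewrite hc.
  (* [T] has order [k] and leading coefficient [q tau], nonzero at [x], so it determines the [k]-th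
     derivative of a solution at [x] from the lower ones. *)
  pose T := dW ^+ (k - N) * (cW q * K).
  have kE : k = (k - N + N)%N by rewrite subnK.
  have sT : (size (T : {poly {poly C}}) <= k.+1)%N.
    rewrite [X in (_ <= X.+1)%N]kE; apply: (size_ore_mul (@derivD C) (@derivM C)).
      by rewrite dWXn size_polyXn.
    rewrite [cW q * K](ore_mulCl (@derivD C) (@derivM C)) mul_polyC.
    by rewrite (leq_trans (size_scale_leq _ _)) // (size_K hK).
  have cT : (T : {poly {poly C}})`_k = q * tau.
    rewrite [X in _`_X = _]kE [LHS](coef_ore_mul (@derivD C) (@derivM C)).
    - by rewrite dWXn coefXn eqxx mul1r coefcW.
    - by rewrite dWXn size_polyXn.
    rewrite [cW q * K](ore_mulCl (@derivD C) (@derivM C)) mul_polyC.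
    by rewrite (leq_trans (size_scale_leq _ _)) // (size_K hK).
  have T0 v : smooth v -> (forall y, wact (cW q * K) v y = 0) ->
      (q * tau).[x] * dern k v x =
      - \sum_(s < k) ((T : {poly {poly C}})`_s).[x] * dern s v x.
    move=> sv hv; have : wact T v x = 0.
      rewrite wactM // (_ : wact (cW q * K) v = (fun y => 0 * v y)).
        by rewrite wact_cst_comm // mul0r.
      by apply/funext => y; rewrite hv mul0r.
    by rewrite (wactE _ _ sT) big_ord_recr /= cT => /eqP; rewrite addrC addr_eq0 => /eqP.
  have qt : (q * tau).[x] != 0 by rewrite hornerM mulf_neq0.
  apply: (mulfI qt); rewrite T0 // mulr_sumr.
  transitivity (\sum_(j < N) c j * - \sum_(s < k) ((T : {poly {poly C}})`_s).[x] * dern s (phi j) x).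
    under [RHS]eq_bigr do rewrite mulrN mulr_sumr.
    rewrite sumrN exchange_big /=; congr (- _); apply: eq_bigr => s _.
    rewrite (IH s) ?mulr_sumr; last by rewrite (leq_trans (ltn_ord s)).
    by apply: eq_bigr => j _; rewrite mulrCA.
  apply: eq_bigr => j _.
  have hj y : wact (cW q * K) (phi j) y = 0 by rewrite wact_cWM wact_Kphi ?mulr0.
  rewrite [RHS]mulrCA; apply: (congr1 (fun v => c j * v)).
  by rewrite (T0 (phi j) (@smooth_phi j) hj).
move=> S; rewrite /wact.
under eq_bigr do rewrite key mulr_sumr.
rewrite exchange_big /=; apply: eq_bigr => j _; rewrite mulr_sumr.
by apply: eq_bigr => s _; rewrite mulrCA.
Qed.

(* Applied to the jets of [hat (f 0) (lam i)] and of the [phi]'s, [ev (others i)]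
   isolates the contributions of the [i]-th point. *)
Definition others i : {poly C} := \prod_(k < n | k != i :> nat) ('X - (lam k)%:P) ^+ 2.

Lemma others_neq0 i : (i < n)%N -> (others i).[lam i] != 0.
Proof.
move=> hi; rewrite horner_prod; apply/prodf_neq0 => k ki.
rewrite horner_exp hornerXsubC expf_neq0 // subr_eq0.
by apply: contraNneq ki => /esym h; apply/eqP; exact: hlam h.
Qed.

Lemma others_root i k q : (k < n)%N -> k != i ->
  ((q * others i).[lam k] = 0) * ((q * others i)^`().[lam k] = 0).
Proof.
by move=> hk ki; rewrite /others (bigD1 (Ordinal hk)) //= mulrCA; exact: double_root.
Qed.

Lemma wact_dWX_scale m c (u : fn) x : smooth u ->
  wact (dW ^+ m) (fun y => c * u y) x = c * dern m u x.
Proof. by move=> su; rewrite wact_cst_comm // wact_dWX. Qed.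

(** Otherwise the jet of [hat (f 0) (lam i)] at some point is a combination of those of the [phi].
    Two polynomials in [L0] applied to this relation force all derivatives of [f 0] to vanish at one
    point. *)
Lemma hat_not_killed i (q : {poly C}) : (i < n)%N -> q != 0 ->
  ~ (forall x, wact (cW q * K) (hat (f 0%N) (lam i)) x = 0).
Proof.
move=> hi q0 h; have kf0 := hf_ker r0; have sh := @smooth_hat _ r a (f 0%N) (lam i) kf0.
have [x hx] := exists_nonroot (mulf_neq0 q0 tau0).
have [c hc] := jets_agree sh hx h.
pose y := x + lam i; pose w := others i.
have w0 : w.[lam i] != 0 := others_neq0 hi.
have sev p u : smooth u -> smooth (wact (ev p) u) by exact: smooth_wact.
(* The factor ['X - (lam i)%:P] annihilates the left side. On the [phi j] of the [i]-th block it
   leaves only the term in the derivative of the polynomial, with weight [w.[lam i]]. *)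
have F0 m : \sum_(j < N | (j %/ r)%N == i) c j * dern m (f (j %% r)%N) y = 0.
  apply: (mulfI w0); rewrite mulr0 mulr_sumr.
  have := hc (dW ^+ m * ev (('X - (lam i)%:P) * w)).
  rewrite wactM // (_ : wact (ev _) (hat _ _) = (fun z => 0 * hat (f 0%N) (lam i) z)); last first.
    by apply/funext => z; rewrite (wact_ev_hat _ _ _ kf0) hornerM hornerXsubC subrr mul0r.
  rewrite wact_dWX_scale // mul0r => h0; rewrite [RHS]h0 big_mkcond; apply: eq_bigr => j _.
  have sj := @smooth_hat _ r a _ (lam (j %/ r)%N) (ker_mod j).
  rewrite wactM; last exact: smooth_phi.
  case: eqVneq => ji.
    rewrite (_ : wact (ev _) (phi j) = (fun z => w.[lam i] * hat (f (j %% r)%N) (lam i) z)).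
      have sji : smooth (hat (f (j %% r)%N) (lam i)) by rewrite -ji.
      by rewrite (wact_dWX_scale _ _ _ sji) mulrCA dern_shift.
    apply/funext => z; rewrite wact_ev_phi ji derivM derivXsubC mul1r hornerD !hornerM.
    by rewrite hornerXsubC subrr !mul0r add0r addr0.
  rewrite (_ : wact (ev _) (phi j) = (fun z => 0 * hat (f (j %% r)%N) (lam (j %/ r)%N) z)).
    by rewrite wact_dWX_scale // mul0r mulr0.
  by apply/funext => z; rewrite wact_ev_phi !others_root ?div_lt // !mul0r addr0.
(* Now [ev w] alone is applied: the [i]-th block contributes derivatives of orders [m] and [m + 1]
   with constant weights, and both sums vanish by [F0]. *)
have f0 m : dern m (f 0%N) y = 0.
  apply: (mulfI w0); rewrite mulr0.
  have := hc (dW ^+ m * ev w).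
  rewrite wactM // (_ : wact (ev _) (hat _ _) = (fun z => w.[lam i] * hat (f 0%N) (lam i) z)); last first.
    by apply/funext => z; rewrite (wact_ev_hat _ _ _ kf0).
  rewrite wact_dWX_scale // dern_shift => ->.
  pose A j := w.[lam i] * dern m.+1 (f (j %% r)%N) y +
    (w.[lam i] * gam i + w^`().[lam i]) * dern m (f (j %% r)%N) y.
  transitivity (\sum_(j < N | (j %/ r)%N == i) c j * A j); last first.
    rewrite (eq_bigr (fun j : 'I_N => w.[lam i] * (c j * dern m.+1 (f (j %% r)%N) y) +
      (w.[lam i] * gam i + w^`().[lam i]) * (c j * dern m (f (j %% r)%N) y))); last first.
      by move=> j _; rewrite /A mulrDr mulrCA [X in _ + X]mulrCA.
    by rewrite big_split /= -!mulr_sumr (F0 m) (F0 m.+1) !mulr0 addr0.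
  rewrite [RHS]big_mkcond; apply: eq_bigr => j _.
  have sj := @smooth_hat _ r a _ (lam (j %/ r)%N) (ker_mod j).
  rewrite wactM; last exact: smooth_phi.
  case: eqVneq => ji.
    congr (_ * _); rewrite -wactM; last exact: smooth_phi.
    rewrite phiE chatE -wactM // ji.
    have -> : dW ^+ m * ev w * (dW + cstW (gam i)) =
       (dW ^+ m.+1 + cstW (gam i) * dW ^+ m) * ev w + dW ^+ m * ev w^`().
      rewrite -mulrA mulrDr evalL0_dW (cstW_comm (ev w)) addrAC mulrDr; congr (_ + _).
      by rewrite -mulrDl mulrA mulrDr -exprSr (cstW_comm (dW ^+ m)).
    have evh p z : wact (ev p) (hat (f (j %% r)%N) (lam i)) z =
        p.[lam i] * hat (f (j %% r)%N) (lam i) z.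
      by rewrite (wact_ev_hat _ _ _ (ker_mod j)).
    have sji : smooth (hat (f (j %% r)%N) (lam i)) by rewrite -ji.
    have evE p : wact (ev p) (hat (f (j %% r)%N) (lam i)) =
        (fun z => p.[lam i] * hat (f (j %% r)%N) (lam i) z).
      by apply/funext => z; exact: evh.
    rewrite wactD !wactM // !evE wactD wact_dWX_scale //.
    rewrite wact_cWM hornerC !wact_dWX_scale //.
    by rewrite !dern_shift -/y /A mulrDl -addrA; congr (_ + (_ + _)); rewrite mulrCA mulrA.
  rewrite (_ : wact (ev _) (phi j) = (fun z => 0 * hat (f (j %% r)%N) (lam (j %/ r)%N) z)).
    by rewrite wact_dWX_scale // mul0r mulr0.
  by apply/funext => z; rewrite wact_ev_phi -[w]mul1r !others_root ?div_lt // !mul0r addr0.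
(* The column of [f 0] in the Wronskian matrix at [y] is zero, against determinant 1. *)
have := hf_wr y; rewrite (expand_det_col _ (Ordinal r0)) big1.
  by move/eqP; rewrite eq_sym oner_eq0.
by move=> k _; rewrite mxE /= f0 mul0r.
Qed.

(** Apply [q K p(L0) = Q K] to [phi (i * r)], which pairs the [i]-th condition with [f 0]. As [K]
    kills this [phi], what remains is [p'(lam i)] times [q K] on [hat (f 0) (lam i)], excluded by
    [hat_not_killed]. *)
Lemma crit_of_RTL p : RTL K (L0w r a) p -> forall i, (i < n)%N -> p^`().[lam i] = 0.
Proof.
move=> /RTL_clear [q [Q [q0 h]]] i hi; apply/eqP; apply: contrapT => /negP p0.
apply: (hat_not_killed hi q0) => x.
have kN : (i * r < N)%N by rewrite mulnC ltn_pmul2l.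
have kd : (i * r %/ r)%N = i by rewrite mulnK.
have km : (i * r %% r)%N = 0%N by rewrite modnMl.
have sh := @smooth_hat _ r a _ (lam i) (hf_ker r0).
have sp := @smooth_phi (i * r)%N.
apply: (mulfI p0); rewrite mulr0.
have := congr1 (fun T : weylR => wact T (phi (i * r)%N) x) h.
rewrite [RHS]wactM // (_ : wact K (phi (i * r)%N) = (fun y => 0 * phi (i * r)%N y)); last first.
  by apply/funext => y; rewrite wact_Kphi // mul0r.
rewrite (wact_cst_comm _ _ _ sp) mul0r => <-.
have e : wact (ev p) (phi (i * r)%N) =
   (fun y => p.[lam i] * phi (i * r)%N y + wact (cstW p^`().[lam i]) (hat (f 0%N) (lam i)) y).
  by apply/funext => y; rewrite wact_ev_phi kd km wact_cW hornerC.
have sv : smooth (wact (cstW p^`().[lam i]) (hat (f 0%N) (lam i))) by exact: smooth_wact.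
rewrite [LHS](congr1 (fun t => p^`().[lam i] * t) (wact_cWM q K _ x)).
rewrite [RHS](wact_cWM q (K * ev p) _ x) (wactM K (ev p) x sp) e.
rewrite (wact_lin K _ x sp sv) (@wact_Kphi (i * r)%N x kN) mulr0 add0r.
by rewrite -(wactM _ _ _ sh) [K * _]cstW_comm wact_cWM hornerC mulrCA.
Qed.

(** Double zeros make both terms of [wact_ev_phi] vanish, so [dpoly(L0)] kills every [phi] of index
    below [N]. *)
Definition dpoly : {poly C} := \prod_(k < n) ('X - (lam k)%:P) ^+ 2.

Lemma dpoly_root k : (k < n)%N -> (dpoly.[lam k] = 0) * (dpoly^`().[lam k] = 0).
Proof.
by move=> hk; rewrite /dpoly (bigD1 (Ordinal hk)) //=; exact: double_root.
Qed.

Lemma dpoly_neq0 : dpoly != 0.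
Proof. by apply/prodf_neq0 => k _; rewrite expf_neq0 // polyXsubC_eq0. Qed.

Lemma size_dpoly : (1 < size dpoly)%N.
Proof.
apply: (root_size_gt1 (a := lam 0%N)); first exact: dpoly_neq0.
by rewrite /root (dpoly_root hn).1.
Qed.

Lemma K_neq0 : K != 0.
Proof. by apply: contraNneq tau0 => ->; rewrite coef0. Qed.

(** [flat] sends [q(L0)] back to the polynomial [q]. *)
Lemma evalW_neq0 q : q != 0 -> ev q != 0.
Proof.
move=> q0; apply: contraNneq q0 => h.
by rewrite -cW_eq0 -(flat_ev r a) h raddf0.
Qed.

Lemma flat_K_neq0 : flat r a K != 0.
Proof.
by apply: contraNneq K_neq0 => h; rewrite -(flatK r a K) h raddf0.
Qed.

Lemma dpoly_div : exists m, exists Q : weylR, cW (tau ^+ m) * ev dpoly = Q * K.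
Proof.
apply: phi_div => j x hj.
by rewrite wact_ev_phi !dpoly_root ?div_lt // !mul0r addr0.
Qed.

Lemma RTL_flat : exists p, RTL (flat r a K) (L0w r a) p /\ (1 < size p)%N.
Proof.
have [m [Q hQ]] := dpoly_div; pose q := tau ^+ m.
have q0 : q != 0 by rewrite expf_neq0.
have qd0 : cW q * ev dpoly != 0.
  by apply: weyl_mul_neq0; [rewrite cW_eq0|apply: evalW_neq0; exact: dpoly_neq0].
have Q0 : Q != 0.
  by apply: contraNneq qd0 => Q0; rewrite hQ Q0 (mul0r K).
have [M [S hS]] := ore_right q Q 1.
have [M' [S' hS']] := ore_ev r a dpoly (S * (cW 'X * K)).
(* Moved left across [Q], the power [q ^+ M] releases a factor [q]. The factor ['X] makes the
   polynomial non-constant whatever [q] and [M] are. *)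
exists (q ^+ M * 'X); split; last first.
  rewrite size_mulX ?expf_neq0 // ltnS lt0n size_poly_eq0; exact: expf_neq0.
(* Multiplied by [Q] on the left, both sides become [q d(L0) S'] with [d] the polynomial [dpoly],
   because [Q K = q d(L0)]. *)
have e : cW (q ^+ M * 'X) * K * ev (dpoly ^+ M') = K * S'.
  apply: (weyl_mulfI Q0); rewrite [RHS]mulrA -hQ -[RHS]mulrA -hS' rmorphM /=.
  by rewrite !mulrA hS expr1.
apply: (@RTL_of _ _ _ _ (flat r a S') _ (dpoly ^+ M')); first by rewrite expf_neq0 // dpoly_neq0.
by have := congr1 (flat r a) e; rewrite !flatM flat_ev flat_cW.
Qed.

End Main.

(** * The algebra of operators conjugate to polynomials in [L0] *)

Section Conjugation.
Variable R : realType.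
Local Notation C := (Cplx R).
Variables (r : nat) (a : nat -> C) (K : weylR R) (t : {poly C}).
Local Notation ev := (evalW (L0R r a)).
Hypotheses (K0 : K != 0) (t0 : t != 0).

Definition monicD : DopR R := cD (tofracC t)^-1 * toDr K.

Definition conjugates (p : {poly C}) (Q : DopR R) := Q * monicD = monicD * toDr (ev p).

Lemma conjugatesE p (Q : Dop R) :
  Dmul Q (Dmul (tofracC t)^-1%:P (toD K)) =
  Dmul (Dmul (tofracC t)^-1%:P (toD K)) (toD (whorner p (L0w r a))) <->
  conjugates p Q.
Proof.
by rewrite /conjugates; split=> h; move: h; rewrite whornerE.
Qed.

Lemma monicD_neq0 : monicD != 0.
Proof.
apply: (ore_mul_neq0 (@fderivD R) (@fderivM R)); last by rewrite [_ == _]toDr_eq0.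
by rewrite polyC_eq0 invr_eq0 tofracC_eq0.
Qed.

Lemma conjugates1 : conjugates 1 1.
Proof. by rewrite /conjugates !rmorph1 (mul1r monicD) (mulr1 monicD). Qed.

Lemma conjugatesD p q P Q : conjugates p P -> conjugates q Q -> conjugates (p + q) (P + Q).
Proof.
by move=> hP hQ; rewrite /conjugates mulrDl hP hQ !rmorphD /= mulrDr.
Qed.

Lemma conjugatesN p P : conjugates p P -> conjugates (- p) (- P).
Proof. by move=> hP; rewrite /conjugates mulNr hP !rmorphN /= mulrN. Qed.

Lemma conjugatesM p q P Q : conjugates p P -> conjugates q Q -> conjugates (p * q) (P * Q).
Proof.
move=> hP hQ; rewrite /conjugates -(mulrA P) hQ (mulrA P) hP.
rewrite (rmorphM (evalW (L0R r a))) (rmorphM (@toDr R)) /=; exact/esym/mulrA.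
Qed.

(** The nonzero [monicD] cancels on the right, so [p] determines its conjugate. Commutativity of the
    ring comes from this. *)
Lemma conjugates_inj p P Q : conjugates p P -> conjugates p Q -> P = Q.
Proof.
move=> hP hQ; apply: (@Dop_mulIf _ _ _ monicD); first exact: monicD_neq0.
exact: etrans hP (esym hQ).
Qed.

End Conjugation.

Theorem mainTheorem2 (R : realType)
  (* the operator L0 and the basis f_0,...,f_{r-1} of ker L0 *)
  (r : nat) (a : nat -> Cplx R) (f : nat -> cfun R)
  (hr : (1 < r)%N)
  (hf_ker : forall j, (j < r)%N -> inkerL0 r a (f j))
  (hf_span : forall g : cfun R, inkerL0 r a g ->
     exists c : nat -> Cplx R, forall x, g x = \sum_(j < r) c j * f j x)
  (hf_wr : forall x : Cplx R, \det (Wr r f x) = 1)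
  (* C in the class D: basis c_i = delta_{lam_i} o (d_z + gam_i), i < n *)
  (n : nat) (hn : (0 < n)%N) (lam gam : nat -> Cplx R)
  (hlam : forall i j, (i < n)%N -> (j < n)%N -> lam i = lam j -> i = j)
  (* \bar K_C = kappa |Wr(phi_1,...,phi_N, .)|, an element Kb of the Weyl
     algebra whose coefficient of d^N (N = r n) is a monic polynomial *)
  (kappa : Cplx R) (Kb : weyl R)
  (hkappa : kappa != 0)
  (hKb : forall (u : cfun R) x, wact Kb u x = barK r n f lam gam kappa u x)
  (htau : Kb`_(r * n) \is monic) :
  let L0 := L0w r a in
  let tau := Kb`_(r * n) in                       (* tau_C *)
  let KC : Dop R := Dmul (tofracC tau)^-1%:P (toD Kb) in   (* K_C *)
  let Kf := wflat L0 Kb in                        (* \bar K_C^flat *)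
  let af := lead_coef Kf in                       (* a^flat *)
  let Kt : Dop R := Dmul (tofracC af)^-1%:P (toD Kf) in    (* \tilde K^flat *)
  (* K_C p(L0) K_C^{-1} = Q  means  Q K_C = K_C p(L0) in D *)
  let conjK (p : {poly Cplx R}) (Q : Dop R) := Dmul Q KC = Dmul KC (toD (whorner p L0)) in
  let conjKt (p : {poly Cplx R}) (P : Dop R) := Dmul P Kt = Dmul Kt (toD (whorner p L0)) in
  let RC (Q : Dop R) := exists p, RTL Kb L0 p /\ conjK p Q in   (* \mathcal R_C *)
  (* phi(x,z) = (tau(x) a^flat(z))^{-1} \bar K_C(\hat g)(x,z) *)
  let phi (g : cfun R) (x z : Cplx R) : Cplx R :=
    (tau.[x] * af.[z])^-1 * barK r n f lam gam kappa (fun y => g (y + z)) x in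
  (* (1) *)
  [/\ (exists p, RTL Kb L0 p /\ (1 < size p)%N),
      (exists p, RTL Kf L0 p /\ (1 < size p)%N),
      (forall p, RTL Kb L0 p <-> (forall i, (i < n)%N -> p^`().[lam i] = 0)),
  (* (2) R_C is a commutative subring of D *)
      (forall p, RTL Kb L0 p -> exists Q, conjK p Q)
      /\ RC 1
      /\ (forall Q1 Q2, RC Q1 -> RC Q2 ->
            [/\ RC (Q1 + Q2), RC (- Q1), RC (Dmul Q1 Q2) & Dmul Q1 Q2 = Dmul Q2 Q1]) &
  (* (2) bispectrality, x-side *)
      ((forall p Q, RTL Kb L0 p -> conjK p Q ->
         forall g : cfun R, inkerL0 r a g -> (exists y, g y != 0) ->
         forall x z : Cplx R, tau.[x] != 0 -> af.[z] != 0 -> Dregular Q x ->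
         Dact Q (fun y => phi g y z) x = p.[z] * phi g x z) /\
  (* (2) bispectrality, z-side *)
      (forall p, RTL Kf L0 p ->
         (exists P, conjKt p P) /\
         forall P, conjKt p P ->
         forall g : cfun R, inkerL0 r a g -> (exists y, g y != 0) ->
         forall x z : Cplx R, tau.[x] != 0 -> af.[z] != 0 -> Dregular P z ->
         Dact P (fun w => phi g x w) z = p.[x] * phi g x z))].
Proof.
move=> L0 tau KC Kf af Kt conjK conjKt RC phi.
pose K : weylR R := Kb.
have tau0 : tau != 0 by exact: monic_neq0.
have hcrit p : RTL Kb L0 p <-> (forall i, (i < n)%N -> p^`().[lam i] = 0).
  split; last exact: (@RTL_of_crit R r a f n lam gam kappa K hr hf_ker hkappa hKb tau0).
  exact: (@crit_of_RTL R r a f n lam gam kappa K hr hf_ker hf_wr hlam hkappa hKb tau0).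
have K0 : K != 0 := K_neq0 tau0.
have af0 : af != 0 by rewrite lead_coef_eq0; exact: (flat_K_neq0 a tau0).
have conjKE p Q : conjK p Q <-> @conjugates R r a K tau p Q by exact: conjugatesE.
have conjKtE p Q : conjKt p Q <-> @conjugates R r a (flat r a K) af p Q by exact: conjugatesE.
split.
- exists (dpoly n lam); split; last exact: size_dpoly.
  by apply/hcrit => i hi; exact: (dpoly_root lam hi).2.
- exact: (@RTL_flat R r a f n lam gam kappa K hr hf_ker hkappa hKb tau0).
- exact: hcrit.
- split=> [p hp|].
    have [Q hQ] := conj_exists tau0 hp.
    by exists Q; apply/conjKE.
  split.
    exists 1; split; last by apply/conjKE; exact: conjugates1.
    by apply/hcrit => i _; rewrite -polyC1 derivC horner0.
  move=> Q1 Q2 [p1 [h1 c1]] [p2 [h2 c2]].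
  have {}h1 := (hcrit p1).1 h1; have {}h2 := (hcrit p2).1 h2.
  have {}c1 := (conjKE p1 Q1).1 c1; have {}c2 := (conjKE p2 Q2).1 c2.
  split.
  + exists (p1 + p2); split; last by apply/conjKE; exact: conjugatesD.
    by apply/hcrit => i hi; rewrite derivD hornerD h1 // h2 // addr0.
  + exists (- p1); split; last by apply/conjKE; exact: conjugatesN.
    by apply/hcrit => i hi; rewrite derivN hornerN h1 // oppr0.
  + exists (p1 * p2); split; last by apply/conjKE; exact: conjugatesM.
    by apply/hcrit => i hi; rewrite derivM hornerD !hornerM h1 // h2 // mul0r mulr0 addr0.
  (* Both products are conjugates of [p1 * p2], so they coincide. *)
  apply: (@conjugates_inj R r a K tau K0 tau0 (p1 * p2)); first exact: conjugatesM.
  by rewrite mulrC; exact: conjugatesM.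
split.
  move=> p Q hp /conjKE hQ g kg _ x z tx az rQ.
  apply: (conj_action (c := (af.[z])^-1) tau0 hQ kg tx rQ) => y.
  by rewrite /phi -hKb invfM [_^-1 * _^-1]mulrC.
move=> p hp; split.
  have [Q hQ] := conj_exists af0 hp.
  by exists Q; apply/conjKtE.
move=> P /conjKtE hP g kg _ x z tx az rP.
(* In [z] the constant is [1 / tau(x)], and [wact_flat] turns [Kb] acting in [x] into its flat
   acting in [z]. *)
apply: (conj_action (c := (tau.[x])^-1) af0 hP kg az rP) => y.
by rewrite /phi -hKb invfM (wact_flat K x y kg).
Qed.
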